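(* Let $G=(V^{\mathrm{s}},V^{\mathrm{a}},E)$ be an influence diagram in which every vertex is a utility vertex or has a descendant that is a utility vertex. (1) If $G$ is not soluble, then there exists a parametrization $\rho$ of $G$ such that, for any junction tree $\mathcal{G}$ of $G$, the set of achievable moments $\mathcal{S}(\mathcal{G})$ is not convex. (2) If $G$ is soluble, then Algorithm B described in the context returns a rooted junction tree $\mathcal{G}$ on $G$ such that $\mathcal{P}^{\perp}=\mathcal{S}(\mathcal{G})$ for any parametrization $\rho$ of $G$.
   Context: Influence diagrams. An influence diagram (ID) $G=(V^{\mathrm{s}},V^{\mathrm{a}},E)$ is a finite acyclic digraph with vertex set $V=V^{\mathrm{s}}\sqcup V^{\mathrm{a}}$, where $V^{\mathrm{a}}$ is the set of decision vertices and $V^{\mathrm{s}}$ is the disjoint union of the chance vertices and the utility vertices $V^{\mathrm{r}}$; utility vertices have no children. $\mathrm{pa}(v)$ denotes the parents of $v$, $\mathrm{fa}(v)=\{v\}\cup\mathrm{pa}(v)$, $\mathrm{dsc}_G(v)$ the descendants of $v$ in $G$ (vertices $u\ne v$ reachable by a directed path from $v$). A parametrization $\rho=(\mathcal{X}_V,\mathfrak{p},r)$ consists of finite nonempty sets $\mathcal{X}_v$ ($v\in V$), conditional distributions $\mathfrak{p}=\{p_{v|\mathrm{pa}(v)}\}_{v\in V^{\mathrm{s}}}$ on $\mathcal{X}_v$ given $\mathcal{X}_{\mathrm{pa}(v)}$, and rewards $r_v:\mathcal{X}_v\to\mathbb{R}$, $v\in V^{\mathrm{r}}$; $\mathcal{X}_C=\prod_{v\in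 C}\mathcal{X}_v$. A policy is $\delta=(\delta_{v|\mathrm{pa}(v)})_{v\in V^{\mathrm{a}}}\in\Delta$, a family of conditional distributions on $\mathcal{X}_v$ given $\mathcal{X}_{\mathrm{pa}(v)}$. It induces $\mathbb{P}_\delta(X_V=x_V)=\prod_{v\in V^{\mathrm{s}}}p_{v|\mathrm{pa}(v)}(x_v|x_{\mathrm{pa}(v)})\prod_{v\in V^{\mathrm{a}}}\delta_{v|\mathrm{pa}(v)}(x_v|x_{\mathrm{pa}(v)})$. Solubility. The augmented graph $G^\dagger$ is obtained from $G$ by adding for each $w\in V^{\mathrm{a}}$ a vertex $\vartheta_w$ and the arc $(\vartheta_w,w)$; $\vartheta_{V^{\mathrm{a}}}=\{\vartheta_w\}_{w\in V^{\mathrm{a}}}$. A decision vertex $u$ is s-reachable from a decision vertex $v$ if $\vartheta_u$ is not d-separated from $\mathrm{dsc}_G(v)$ given $\mathrm{fa}(v)$ in $G^\dagger$. The relevance graph $H$ of $G$ is the digraph on $V^{\mathrm{a}}$ whose arcs are the pairs $(v,u)$ such that $u$ is s-reachable from $v$. $G$ is soluble if $H$ is acyclic. Junction trees. A junction tree of $G$ is an undirected tree whose nodes are subsets of $V$, such that each $\mathrm{fa}(v)$ is contained in some node, and for any two nodes $C_1,C_2$ every node on the path between them contains $C_1\cap C_2$. For a junction tree $\mathcal{G}$, $\mathcal{S}(\mathcal{G})$ is the set of vectors of moments $(\mu_C)_C$ ($C$ ranging over nodes of $\mathcal{G}$) for which there is $\delta\in\Delta$ with $\mu_C(x_C)=\mathbb{P}_\delta(X_C=x_C)$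 for all $C$ and $x_C$. A rooted junction tree (RJT) $\mathcal{G}$ on $G$ is a rooted tree (arcs directed away from the root) with nodes in $2^V$ whose underlying undirected graph is a junction tree of $G$ and such that $\mathrm{fa}(v)\subseteq C_v$ for all $v$, where $C_v$ (root clique of $v$) is the root of the subtree induced by the nodes containing $v$. Convention: if $G$ is not weakly connected, the output of the algorithms below is a disjoint union of RJTs, one for each weakly connected component, and this is still called an RJT on $G$. Put $\check C_v=C_v\setminus\{v\}$. Polytopes, for an RJT $\mathcal{G}$ with nodes exactly $(C_v)_{v\in V}$, each $C_v$ being the root clique of $v$ only (equalities between functions are pointwise). $\mathcal{L}_{\mathcal{G}}$ is the set of $\mu=(\mu_{C_v},\mu_{\check C_v})_{v\in V}$ such that each $\mu_{C_v}$ is a probability distribution on $\mathcal{X}_{C_v}$, adjacent nodes $C,C'$ satisfy $\sum_{x_{C\setminus C'}}\mu_C=\sum_{x_{C'\setminus C}}\mu_{C'}$, and $\mu_{\check C_v}=\sum_{x_v}\mu_{C_v}$. $\overline{\mathcal{P}}=\{\mu\in\mathcal{L}_{\mathcal{G}}:\mu_{C_v}=\mu_{\check C_v}\,p_{v|\mathrm{pa}(v)}\ \forall v\in V^{\mathrm{s}}\}$. In this case elements of $\mathcal{S}(\mathcal{G})$ are also viewed with the redundant components $\mu_{\check C_v}=\sum_{x_v}\mu_{C_v}$, so that $\mathcal{S}(\mathcal{G})=\{\mu\in\overline{\mathcal{P}}:\exists\delta\in\Delta,\ \mu_{C_v}=\mu_{\check C_v}\,\delta_{v|\mathrm{pa}(v)}\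 \forall v\in V^{\mathrm{a}}\}$. For $C\subseteq V$, $C^{\perp}$ is the largest subset $D$ of $C$ such that, for any parametrization of $G$, the conditional distribution $\mathbb{P}_\delta(X_D|X_{C\setminus D})$ does not depend on the policy $\delta$ (at values of $X_{C\setminus D}$ of positive probability); it exists and equals $\{v\in C: v\perp\vartheta_{V^{\mathrm{a}}}\mid C\setminus\{v\}\}$, with $\perp$ d-separation in $G^\dagger$. $C^{\not\perp}=C\setminus C^{\perp}$, and $p_{C^{\perp}|C^{\not\perp}}$ is the common conditional distribution: $p_{C^\perp|C^{\not\perp}}(x_{C^\perp}|x_{C^{\not\perp}})=\mathbb{P}_\delta(X_{C^\perp}=x_{C^\perp}|X_{C^{\not\perp}}=x_{C^{\not\perp}})$ for any $\delta$ with $\mathbb{P}_\delta(X_{C^{\not\perp}}=x_{C^{\not\perp}})>0$, and (by convention) uniform if there is no such $\delta$. $\mathcal{P}^{\perp}=\{\mu\in\overline{\mathcal{P}}:\mu_{C_v}=p_{C_v^{\perp}|C_v^{\not\perp}}\sum_{x_{C_v^{\perp}}}\mu_{C_v}\ \forall v\in V^{\mathrm{a}}\}$. Algorithm A (input: $G$ and a topological order $\preceq$ on $G$). Start with $\mathcal{A}'=\emptyset$. Process the vertices $v$ in reverse order of $\preceq$ (largest first): set $C_v=\mathrm{fa}(v)\cup\bigcup_{w:(v,w)\in\mathcal{A}'}(C_w\setminus\{w\})$; if $C_v\setminus\{v\}\neq\emptyset$, let $u$ be the maximum of $C_v\setminus\{v\}$ for $\preceq$ and add $(u,v)$ to $\mathcal{A}'$.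 Output the digraph with nodes $(C_v)_{v\in V}$ and arcs $\{(C_u,C_v):(u,v)\in\mathcal{A}'\}$. Algorithm B (input: a soluble ID $G$). Compute the relevance graph $H$ and an arbitrary topological order $\preceq_H$ on $V^{\mathrm{a}}$ for $H$. Let $E'=E\cup\{(u,v)\in V^{\mathrm{a}}\times V^{\mathrm{a}}:u\prec_H v\}$ and $G'=(V,E')$. Let $E''=E\cup\{(u,v)\in V^{\mathrm{s}}\times V^{\mathrm{a}}:u\notin\mathrm{dsc}_{G'}(v)\}$ and $G''=(V,E'')$. Compute an arbitrary topological order $\preceq$ on $G''$ and return the output of Algorithm A on $(G,\preceq)$. *)

(* Defs.v *)
(* MathComp, with the real numbers, classical reasoning and convex sets of
   MathComp-Analysis. *)
From HB Require Import structures.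
From mathcomp Require Import all_boot all_order all_algebra.
From mathcomp Require Import boolp classical_sets reals convex.

Set Implicit Arguments.
Unset Strict Implicit.
Unset Printing Implicit Defensive.

Import Order.TTheory GRing.Theory Num.Theory.

Local Open Scope ring_scope.
Local Open Scope set_scope.

(** * Graphs *)

Definition acyclic (T : finType) (e : rel T) : Prop :=
  forall c : seq T, cycle e c -> c = [::].

Definition usym (T : finType) (e : rel T) : rel T :=
  [rel x y | e x y || e y x].

Definition subrel_on (T : finType) (N : {set T}) (e : rel T) : rel T :=
  [rel x y | [&& x \in N, y \in N & e x y]].

Definition parents (T : finType) (e : rel T) (v : T) : {set T} :=
  [set u | e u v].

Definition family (T : finType) (e : rel T) (v : T) : {set T} :=
  v |: parents e v.

Definition dsc (T : finType) (e : rel T) (v : T) : {set T} :=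
  [set u | (u != v) && connect e v u].

(* Total orders [le] on the set [A] in which [x] strictly precedes [y] for every
   arc [(x, y)] between elements of [A]; the values of [le] off [A] are not
   constrained. *)
Definition topological_order (T : finType) (A : {set T}) (e : rel T)
    (le : rel T) : Prop :=
  [/\ {in A, reflexive le}, {in A &, antisymmetric le},
      {in A & &, transitive le}, {in A &, total le}
    & {in A &, forall x y, e x y -> (x != y) && le x y}].

Definition simple_path (T : finType) (e : rel T) (x y : T) (p : seq T) : Prop :=
  [/\ path e x p, uniq (x :: p) & last x p = y].

(* An undirected edge gives a cycle of length 2 for the symmetric relation [e],
   whence the bound in the last clause. *)
Definition is_tree (T : finType) (N : {set T}) (e : rel T) : Prop :=
  [/\ N != finset.set0,
      symmetric e /\ irreflexive e,
      forall x y, e x y -> (x \in N) && (y \in N),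
      {in N &, forall x y, connect e x y}
    & forall c : seq T, ucycle e c -> (size c <= 2)%N].

Definition is_rooted_tree (T : finType) (N : {set T}) (a : rel T) (r : T)
    : Prop :=
  [/\ is_tree N (usym a),
      forall x y, a x y -> ~~ a y x,
      r \in N
    & {in N, forall x, connect a r x}].

(** * d-separation *)

(* The trail [x :: p] (orientation of arcs ignored) is not blocked by [Z]:
   each collider on it is in [Z] or has a descendant in [Z], and no other inner
   vertex is in [Z]. *)
Definition active_trail (T : finType) (e : rel T) (Z : {set T})
    (x y : T) (p : seq T) : Prop :=
  simple_path (usym e) x y p /\
  forall (s1 s2 : seq T) (a b c : T), x :: p = s1 ++ [:: a, b, c & s2] ->
    if e a b && e c b then exists2 z, z \in Z & connect e b z
    else b \notin Z.

Definition d_separated (T : finType) (e : rel T) (A B Z : {set T}) : Prop :=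
  forall x y p, x \in A -> y \in B -> ~ active_trail e Z x y p.

(** * Influence diagrams *)

Record influence_diagram (V : finType) : Type := InfluenceDiagram {
  id_arc : rel V;
  Va : {set V};
  Vr : {set V};
  arc_acyclic : acyclic id_arc;
  Va_Vr_disjoint : [disjoint Va & Vr];
  utility_childless : forall u v, u \in Vr -> ~~ id_arc u v
}.

Section InfluenceDiagrams.
Variables (V : finType) (G : influence_diagram V).

(* Chance and utility vertices together. *)
Definition Vs : {set V} := ~: Va G.

Definition pa : V -> {set V} := parents (id_arc G).
Definition fa : V -> {set V} := family (id_arc G).

(* The vertices of the augmented graph: [inr w] stands for vartheta_w. *)
Definition aug : finType := (V + {w : V | w \in Va G})%type.

Definition aug_arc : rel aug := fun x y =>
  match x, y with
  | inl u, inl v => id_arc G u v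
  | inr w, inl v => val w == v
  | _, inr _ => false
  end.

Definition aug_set (A : {set V}) : {set aug} := [set inl v | v in A].

Definition s_reachable (v : V) (u : {w : V | w \in Va G}) : Prop :=
  ~ d_separated aug_arc [set inr u] (aug_set (dsc (id_arc G) v))
      (aug_set (fa v)).

(* The relevance graph, as a relation on [V] all of whose arcs are in [Va]. *)
Definition relevance_arc : rel V := fun v u =>
  (v \in Va G) &&
  `[< exists2 w : {w : V | w \in Va G}, val w = u & s_reachable v w >].

Definition soluble : Prop := acyclic relevance_arc.

(** * Junction trees *)

(* Junction trees of the subgraph induced by [K], for [K] a union of weakly
   connected components of [G]. *)
Definition junction_tree_on (K : {set V}) (N : {set {set V}})
    (e : rel {set V}) : Prop :=
  [/\ is_tree N e,
      {in N, forall C : {set V}, C \subset K},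
      {in K, forall v, exists2 C : {set V}, C \in N & fa v \subset C}
    & {in N &, forall (C1 C2 : {set V}) (p : seq {set V}),
        simple_path e C1 C2 p ->
        forall C, C \in C1 :: p -> C1 :&: C2 \subset C}].

Definition junction_tree : {set {set V}} -> rel {set V} -> Prop :=
  junction_tree_on [set: V].

(* [C] is the root of the subtree induced by the nodes containing [v]. *)
Definition root_clique (N : {set {set V}}) (a : rel {set V}) (v : V)
    (C : {set V}) : Prop :=
  let Nv := [set D in N | v \in D] in
  C \in Nv /\ {in Nv, forall D, connect (subrel_on Nv a) C D}.

Definition rooted_junction_tree_on (K : {set V}) (N : {set {set V}})
    (a : rel {set V}) : Prop :=
  [/\ exists r, is_rooted_tree N a r,
      junction_tree_on K N (usym a)
    & {in K, forall v, exists2 C, root_clique N a v C & fa v \subset C}].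

Definition weak_components : {set {set V}} :=
  equivalence_partition (connect (usym (id_arc G))) [set: V].

(* A disjoint union of rooted junction trees, the one with nodes [P K] being on
   the weakly connected component [K]; a single tree if [G] is connected. *)
Definition rooted_junction_tree (N : {set {set V}}) (a : rel {set V}) : Prop :=
  exists P : {set V} -> {set {set V}},
  [/\ N = \bigcup_(K in weak_components) P K,
      {in weak_components &, forall K L, K != L -> [disjoint P K & P L]},
      forall C D, a C D ->
        exists2 K, K \in weak_components & (C \in P K) && (D \in P K)
    & {in weak_components, forall K,
        rooted_junction_tree_on K (P K) (subrel_on (P K) a)}].

(** * The algorithms *)

(* The clique of each vertex already processed, and the set of pairs [(u, v)]
   with [u] the parent of [v] in the tree under construction. *)
Definition algA_state : Type := ({ffun V -> {set V}} * {set V * V})%type.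

Definition algA_step (le : rel V) (st : algA_state) (v : V) : algA_state :=
  let Cv := fa v :|: \bigcup_(w | (v, w) \in st.2) (st.1 w :\ w) in
  ([ffun w => if w == v then Cv else st.1 w],
   if [pick u in Cv :\ v | [forall w in Cv :\ v, le w u]] is Some u
   then (u, v) |: st.2 else st.2).

Definition algorithmA (le : rel V) : algA_state :=
  foldl (algA_step le) ([ffun => finset.set0], finset.set0)
    (rev (sort le (enum V))).

Definition out_nodes (out : algA_state) : {set {set V}} :=
  [set out.1 v | v : V].

Definition out_arc (out : algA_state) : rel {set V} := fun C D =>
  [exists uv in out.2, (C == out.1 uv.1) && (D == out.1 uv.2)].

(* The arcs of G' = (V, E') and G'' = (V, E''). *)
Definition id_arc' (leH : rel V) : rel V := fun u v =>
  id_arc G u v || [&& u \in Va G, v \in Va G, u != v & leH u v].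

Definition id_arc'' (leH : rel V) : rel V := fun u v =>
  id_arc G u v || [&& u \in Vs, v \in Va G & u \notin dsc (id_arc' leH) v].

(* [out] is a possible output, according to the arbitrary choices of the two
   topological orders. *)
Definition algorithmB (out : algA_state) : Prop :=
  exists leH le : rel V,
    [/\ topological_order (Va G) relevance_arc leH,
        topological_order [set: V] (id_arc'' leH) le
      & out = algorithmA le].

(* No step of the algorithm fails: whatever the choices made so far, the
   required topological orders exist. *)
Definition algorithmB_succeeds : Prop :=
  (exists leH, topological_order (Va G) relevance_arc leH) /\
  (forall leH, topological_order (Va G) relevance_arc leH ->
     exists le, topological_order [set: V] (id_arc'' leH) le).

End InfluenceDiagrams.

(** * Parametrizations and policies *)

Section Moments.
Variables (R : realType) (V : finType) (G : influence_diagram V).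

(* [cfg X C], [cfgV X] and [proj C] are X_C, X_V and the projection of X_V on
   X_C. *)
Definition cfg (X : V -> finType) (C : {set V}) : finType :=
  {dffun forall u : {v : V | v \in C}, X (val u)}.

Definition cfgV (X : V -> finType) : finType := {dffun forall v : V, X v}.

Definition proj (X : V -> finType) (C : {set V}) (z : cfgV X) : cfg X C :=
  [ffun u : {v : V | v \in C} => z (val u)].

Definition cond_family (X : V -> finType) : Type :=
  forall v : V, cfg X (pa G v) -> X v -> R.

Definition is_distribution (T : finType) (q : T -> R) : Prop :=
  (forall x, 0 <= q x) /\ \sum_x q x = 1.

(* The components of [chance_kernel] at decision vertices, and those of [reward]
   off the utility vertices, carry no information: they are not constrained and
   do not appear in any of the notions below. The same holds for the components
   of a policy at vertices of [Vs]. *)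
Record parametrization : Type := Parametrization {
  states : V -> finType;
  states_nonempty : forall v, (0 < #|states v|)%N;
  chance_kernel : cond_family states;
  kernel_distribution :
    forall v, v \in Vs G ->
      forall y, is_distribution (chance_kernel (v := v) y);
  reward : forall v, states v -> R
}.

Variable rho : parametrization.

Definition is_policy (d : cond_family (states rho)) : Prop :=
  forall v, v \in Va G -> forall y, is_distribution (d v y).

Definition prob (d : cond_family (states rho)) (z : cfgV (states rho)) : R :=
  (\prod_(v in Vs G) chance_kernel (proj (pa G v) z) (z v)) *
  (\prod_(v in Va G) d v (proj (pa G v) z) (z v)).

Definition marginal (d : cond_family (states rho)) (C : {set V})
    (x : cfg (states rho) C) : R :=
  \sum_(z | proj C z == x) prob d z.

(** * Achievable moments of a junction tree *)

Definition moment_index (N : {set {set V}}) : finType :=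
  {C : {C : {set V} | C \in N} & cfg (states rho) (val C)}.

Definition moment_space (N : {set {set V}}) : lmodType R :=
  {ffun moment_index N -> R^o}.

Definition achievable (N : {set {set V}}) : set (moment_space N) :=
  [set mu : moment_space N | exists2 d, is_policy d &
     forall i : moment_index N, mu i = marginal d (tagged i)]%classic.

End Moments.

(** * The polytopes *)

(* Functions on the sets X_C are compared through their values at the
   projections of an element [z] of X_V: since the X_v are nonempty, an equality
   for all [z] amounts to the pointwise equality. *)
Section Polytopes.
Variables (R : realType) (V : finType) (G : influence_diagram V).

(* Sum of [m] over the coordinates in [D], the other ones being those of [z]. *)
Definition sum_out (X : V -> finType) (C D : {set V}) (m : cfg X C -> R)
    (z : cfgV X) : R :=
  \sum_(x : cfg X C |
     [forall u : {v : V | v \in C}, (val u \notin D) ==> (x u == z (val u))])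
    m x.

(* P_d(X_D = z_D | X_(C :\: D) = z_(C :\: D)) for [D] included in [C]. *)
Definition cond_prob (rho : parametrization R G)
    (d : cond_family R G (states rho)) (C D : {set V}) (z : cfgV (states rho))
    : R :=
  marginal d (proj C z) / marginal d (proj (C :\: D) z).

Definition policy_independent (C D : {set V}) : Prop :=
  forall (rho : parametrization R G) (d d' : cond_family R G (states rho)),
    is_policy d -> is_policy d' -> forall z : cfgV (states rho),
    0 < marginal d (proj (C :\: D) z) -> 0 < marginal d' (proj (C :\: D) z) ->
    cond_prob d C D z = cond_prob d' C D z.

Definition is_perp (C D : {set V}) : Prop :=
  [/\ D \subset C, policy_independent C D
    & forall D' : {set V},
        D' \subset C -> policy_independent C D' -> D' \subset D].

(* The default value is irrelevant: a largest set always exists. *)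
Definition perp (C : {set V}) : {set V} :=
  odflt finset.set0 [pick D | `[< is_perp C D >]].

Variable rho : parametrization R G.

Definition perp_kernel (C : {set V}) (z : cfgV (states rho)) : R :=
  match pselect (exists d : cond_family R G (states rho),
      is_policy d /\ 0 < marginal d (proj (C :\: perp C) z)) with
  | left h => cond_prob (projT1 (cid h)) C (perp C) z
  | right _ => #|cfg (states rho) (perp C)|%:R^-1
  end.

Variables (Cl : V -> {set V}) (a : rel {set V}).

(* [mom mu v] is the moment on [Cl v], and [mom_check mu v] the redundant one on
   [Cl v :\ v]. *)
Record rjt_moments : Type := RjtMoments {
  mom : forall v, cfg (states rho) (Cl v) -> R;
  mom_check : forall v, cfg (states rho) (Cl v :\ v) -> R
}.

Definition redundant_components (mu : rjt_moments) : Prop :=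
  forall v z,
    mom_check mu (proj (Cl v :\ v) z) = sum_out [set v] (mom mu (v := v)) z.

Definition local_polytope : set rjt_moments :=
  [set mu | [/\ forall v, is_distribution (mom mu (v := v)),
     forall u v, a (Cl u) (Cl v) -> forall z,
       sum_out (Cl u :\: Cl v) (mom mu (v := u)) z
       = sum_out (Cl v :\: Cl u) (mom mu (v := v)) z
   & redundant_components mu]]%classic.

Definition Pbar : set rjt_moments :=
  [set mu | local_polytope mu /\
     forall v, v \in Vs G -> forall z,
       mom mu (proj (Cl v) z)
       = mom_check mu (proj (Cl v :\ v) z)
         * chance_kernel (proj (pa G v) z) (z v)]%classic.

Definition Pperp : set rjt_moments :=
  [set mu | Pbar mu /\
     forall v, v \in Va G -> forall z,
       mom mu (proj (Cl v) z)
       = perp_kernel (Cl v) z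
         * sum_out (perp (Cl v)) (mom mu (v := v)) z]%classic.

Definition achievable_rjt : set rjt_moments :=
  [set mu | (exists2 d : cond_family R G (states rho), is_policy d &
               forall v (x : cfg (states rho) (Cl v)),
                 mom mu x = marginal d x) /\
            redundant_components mu]%classic.

End Polytopes.

Arguments achievable {R V G} rho N.
Arguments marginal {R V G rho} d {C} x.
Arguments mom {R V G rho Cl} _ v x.
Arguments mom_check {R V G rho Cl} _ v x.
Arguments local_polytope {R V G} rho Cl a.
Arguments Pbar {R V G} rho Cl a.
Arguments Pperp {R V G} rho Cl a.
Arguments achievable_rjt {R V G} rho Cl.

(* Main.v *)
(** Suppose that [u] is s-reachable from [v] without being a descendant of [v]; such
    a pair exists if [G] is not soluble, because [G] is acyclic. Let bits run along an
    active trail from vartheta_u to a child [y] of its last vertex, [y] being a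
    descendant of [v]: forks draw a fair bit, the vertices of a chain copy, and a
    collider publishes the sum of its two bits to its descendants, among which is [v].
    From the published sums and the bit of vartheta_u, [v] computes the last bit, so
    for each value of that bit some policy lets [v] always guess it, and [y] sees
    both. A policy with the average of the two families of moments would also always
    guess right; but, when it is followed, flipping all the bits of the trail changes
    neither the positivity of the probability nor what [v] observes.

    Suppose that [G] is soluble. Two decisions with a common descendant are then
    comparable in [G]. Hence, in the order of Algorithm B, the vertices connected to a
    decision [v] through vertices that are not before [v] are descendants of [v], so
    each vertex of [C_v] outside [fa v] is a parent of a descendant of [v], and every
    decision that is an ancestor of [C_v] is an ancestor of [v]. As [v] is
    s-reachable from these decisions, they are not s-reachable from [v], whence
    [C_v :\: fa v] is contained in [perp C_v]. Given a point of [Pperp], the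
    conditional distributions of [X_v] given [X_(pa v)] that it induces form a policy,
    and its moments are those of this policy by induction along the order: for a
    decision [v], the perp constraint says that [mu_(C_v)] is the product of a moment
    of a policy by a function of [X_(fa v)]. *)
Require Import Defs.
From mathcomp Require Import all_boot all_order all_algebra.
From mathcomp Require Import boolp classical_sets reals convex.
From mathcomp Require Import zify ring lra.
From mathcomp Require Import unstable interval_inference.
From mathcomp Require Import fintype finset.

Set Implicit Arguments.
Unset Strict Implicit.
Unset Printing Implicit Defensive.

Import Order.TTheory GRing.Theory Num.Theory.

(** * Acyclic relations and topological orders *)

Section Acyclic.
Variables (T : finType) (e : rel T).
Hypothesis acyc : acyclic e.

Lemma acyclic_connect x y : e x y -> ~~ connect e y x.
Proof.
move=> exy; apply/negP => /connectP[p yp xl].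
suff: y :: p = [::] by [].
by apply: acyc; rewrite /= rcons_path yp -xl.
Qed.

Lemma connect_neqP x y :
  reflect (exists2 z, e x z & connect e z y) ((y != x) && connect e x y).
Proof.
apply: (iffP andP) => [[yx /connectP[[|z p] /= xp yl]]|[z xz zy]].
- by rewrite yl eqxx in yx.
- by case/andP: xp => xz zp; exists z => //; apply/connectP; exists p.
split; last exact: connect_trans (connect1 xz) zy.
by apply: contraTneq zy => ->; exact: acyclic_connect.
Qed.

Lemma acyclic_irr x : e x x = false.
Proof. by apply/negP => /acyclic_connect; rewrite connect0. Qed.

Lemma acyclic_asym x y : e x y -> e y x = false.
Proof.
by move=> /acyclic_connect; apply: contraNF => yx; exact: connect1.
Qed.

(** The number of ancestors is the rank behind most inductions and topological orders: ancestors of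
    [x] are ancestors of [y], and [y] itself is a new one. *)
Lemma acyclic_height x y :
  e x y -> (#|[set z | connect e z x]| < #|[set z | connect e z y]|)%N.
Proof.
move=> xy; apply: proper_card; apply/properP; split.
  by apply/subsetP => z; rewrite !inE => /connect_trans; apply; exact: connect1.
by exists y; rewrite !inE ?connect0 //; exact: acyclic_connect.
Qed.

End Acyclic.

Lemma dsc_step (T : finType) (e : rel T) (acyc : acyclic e) v x y :
  x \in v |: dsc e v -> e x y -> y \in dsc e v.
Proof.
rewrite !inE => vx xy.
have cvx : connect e v x by case/orP: vx => [/eqP->|/andP[]].
apply/andP; split; last exact: connect_trans cvx (connect1 xy).
by apply: contraTneq cvx => <-; exact: acyclic_connect.
Qed.

Lemma topological_order_rank (T : finType) (A : {set T}) (e : rel T)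
    (f : T -> nat) :
  (forall x y, e x y -> (f x < f y)%N) -> exists le, topological_order A e le.
Proof.
move=> ef.
(* Lexicographic order: the enumeration of [T] breaks the ties of [f]. *)
exists (fun x y => (f x < f y)%N || ((f x == f y) && (enum_rank x <= enum_rank y)%N)).
split.
- by move=> x _; rewrite ltnn eqxx leqnn.
- move=> x y _ _ xy; apply: enum_rank_inj; apply: ord_inj; move: xy; lia.
- by move=> y x z _ _ _; lia.
- by move=> x y _ _; lia.
move=> x y _ _ exy; rewrite (ef _ _ exy) andbT.
by apply: contraTneq (ef _ _ exy) => ->; rewrite ltnn.
Qed.

Lemma topological_connect (T : finType) (e le : rel T) x y :
  topological_order [set: T] e le -> connect e x y -> le x y.
Proof.
case=> rl _ tl _ el /connectP[p]; elim: p x => [|z p IH] x /= => [_ ->|].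
  by apply: rl; rewrite inE.
case/andP=> xz /IH{}IH /IH zy.
by apply: (tl z) => //; have /andP[] := el x z (in_setT _) (in_setT _) xz.
Qed.

(** * Active walks *)

Section ActiveWalk.
Variables (T : finType) (e : rel T) (Z : {set T}) (x0 : T).

Definition unblocked a b c : Prop :=
  if e a b && e c b then exists2 z, z \in Z & connect e b z else b \notin Z.

(** Unlike an active trail, a walk may repeat vertices, so it can be extended at its end without
    further checks; [active_walk_uniq] removes the repetitions afterwards. *)
Definition active_walk (s : seq T) : Prop :=
  (forall i, (i.+1 < size s)%N -> usym e (nth x0 s i) (nth x0 s i.+1)) /\
  (forall i, (i.+2 < size s)%N ->
     unblocked (nth x0 s i) (nth x0 s i.+1) (nth x0 s i.+2)).

Hypothesis acyc : forall x y, e x y -> ~~ connect e y x.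

Lemma active_walk_rcons s b c : active_walk (rcons s b) -> usym e b c ->
  (s = [::] \/ unblocked (last x0 s) b c) -> active_walk (rcons (rcons s b) c).
Proof.
move=> [ap au] bc H; split=> i; rewrite !size_rcons => hi.
  have [li|li] := ltnP i (size s).
    have := ap i; rewrite size_rcons ltnS => /(_ li).
    by rewrite !nth_rcons size_rcons; do ![case: ifP; try lia].
  have -> : i = size s by lia.
  by rewrite !nth_rcons size_rcons; do ![case: ifP; try lia].
have [li|li] := ltnP i.+1 (size s).
  have := au i; rewrite size_rcons ltnS => /(_ li).
  by rewrite !nth_rcons size_rcons; do ![case: ifP; try lia].
have Ei : i.+1 = size s by lia.
case: H => [E|]; first by rewrite E /= in Ei.
by rewrite !nth_rcons size_rcons -Ei -nth_last -Ei /=;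
   do ![case: ifP; try lia].
Qed.

(** A directed path makes neither [a] nor a later vertex a collider, and a vertex of [Z] on it would
    be a descendant of [a]. *)
Lemma active_walk_down s a y : active_walk (rcons s a) ->
  (forall z, z \in Z -> ~~ connect e a z) -> connect e a y ->
  exists2 s', active_walk (rcons s' y) & nth x0 (rcons s' y) 0 = nth x0 (rcons s a) 0.
Proof.
move=> + + /connectP[p]; elim: p s a => [|b p IH] s a /=.
  by move=> ? _ _ ->; exists s.
move=> asa aZ /andP[ab bp] yl.
have [||s' ? E] := IH (rcons s a) b _ _ bp yl.
- apply: active_walk_rcons => //; first by rewrite /usym /= ab.
  right; rewrite /unblocked ifF; last first.
    by apply/negP => /andP[_ ba]; have := acyc ab; rewrite (connect1 ba).
  by apply: contraL (connect0 e a) => /aZ.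
- move=> z /aZ; apply: contraNN; apply: connect_trans; exact: connect1.
by exists s' => //; rewrite E; case: (s).
Qed.

(* A loop is removed. The only new triple is the one around its base [b]; if [b]
   becomes a collider, then the loop either left [b] through an arc into [b], or
   descends from [b] to a collider, since it cannot descend back to [b]. *)
Lemma active_walk_uniq s : active_walk s -> s != [::] ->
  exists s', [/\ active_walk s', uniq s', s' != [::],
     nth x0 s' 0 = nth x0 s 0 & last x0 s' = last x0 s].
Proof.
have [n] := ubnP (size s); elim: n s => // n IH s sn [ap au] s0.
have [us|nus] := boolP (uniq s); first by exists s; split.
have [i [j [ij js Eij]]] : exists i j,
    [/\ (i < j)%N, (j < size s)%N & nth x0 s i = nth x0 s j].
  by have /(uniqPn x0)[i [j [? ? ?]]] := nus; exists i, j.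
have sizes : size (take i s ++ drop j s) = (i + (size s - j))%N.
  by rewrite size_cat size_takel ?size_drop //; lia.
have nths k : nth x0 (take i s ++ drop j s) k =
    if (k < i)%N then nth x0 s k else nth x0 s (k - i + j).
  rewrite nth_cat size_takel; last by lia.
  by case: ifP => ki; [rewrite nth_take | rewrite nth_drop addnC].
have nths' k : (k <= i)%N -> nth x0 (take i s ++ drop j s) k = nth x0 s k.
  rewrite nths leq_eqVlt => /orP[/eqP->|->] //.
  by rewrite ltnn subnn add0n.
have nths2 k : (i <= k)%N ->
   nth x0 (take i s ++ drop j s) k = nth x0 s (k - i + j).
  by move=> ik; rewrite nths ltnNge ik.
have neq0 : take i s ++ drop j s != [::].
  by rewrite -size_eq0 sizes; lia.
have [||s' [? ? ? E1 E2]] := IH (take i s ++ drop j s) _ _ neq0.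
- by rewrite sizes; lia.
- split=> k; rewrite sizes => hk.
    have [ki|ik] := ltnP k i.
      by rewrite !nths'; try lia; apply: ap; lia.
    rewrite !nths2 //; try lia.
    have -> : (k.+1 - i + j = (k - i + j).+1)%N by lia.
    by apply: ap; lia.
  have [ki|ik] := ltnP k.+1 i.
    by rewrite !nths' //; try lia; apply: au; lia.
  have [ki|ki] := leqP i k.
    rewrite !nths2 //; try lia.
    have -> : (k.+1 - i + j = (k - i + j).+1)%N by lia.
    have -> : (k.+2 - i + j = (k - i + j).+2)%N by lia.
    by apply: au; lia.
  have Ek : k.+1 = i by lia.
  rewrite (nths' k) ?(nths' k.+1) ?(nths2 k.+2); try lia.
  have -> : (k.+2 - i + j = j.+1)%N by lia.
  have tri : unblocked (nth x0 s k) (nth x0 s k.+1) (nth x0 s k.+2).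
    by apply: au; lia.
  have trj : unblocked (nth x0 s j.-1) (nth x0 s k.+1) (nth x0 s j.+1).
    have := au j.-1; rewrite (_ : j.-1.+1 = j); last by lia.
    by rewrite Ek Eij; apply; lia.
  rewrite /unblocked; case: ifP => [/andP[ekb ejb]|nc]; last first.
    move/negbT: nc; rewrite negb_and => /orP[nc|nc].
      by move: tri; rewrite /unblocked (negbTE nc).
    by move: trj; rewrite /unblocked (negbTE nc) andbF.
  set b := nth x0 s k.+1 in tri trj ekb ejb *.
  case: (pselect (exists2 z, z \in Z & connect e b z)) => // nZ.
  exfalso.
  suff H l : (k.+1 + l < j)%N ->
      connect e b (nth x0 s (k.+1 + l)) /\
      e (nth x0 s (k.+1 + l)) (nth x0 s (k.+1 + l).+1).
    have [] := H (j - k.+2)%N; first by lia.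
    rewrite (_ : (k.+1 + (j - k.+2)).+1 = j); last by lia.
    by rewrite -Eij -Ek -/b => + /acyc; move=> ->.
  have ue q : (q.+1 < size s)%N -> ~~ e (nth x0 s q.+1) (nth x0 s q) ->
      e (nth x0 s q) (nth x0 s q.+1).
    by move=> /ap /orP[|->].
  elim: l => [|l IHl] hl.
    rewrite addn0 connect0; split=> //.
    apply: ue; first by lia.
    apply/negP => eb; move: tri; rewrite /unblocked ekb.
    by rewrite (_ : e _ b) // => -[z zZ bz]; apply: nZ; exists z.
  have [|bl el] := IHl; first by lia.
  have bl' : connect e b (nth x0 s (k.+1 + l).+1).
    exact: connect_trans bl (connect1 el).
  rewrite addnS; split => //.
  apply: ue; first by lia.
  apply/negP => eb; have := au (k.+1 + l)%N; rewrite /unblocked el eb /=.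
  case; first by lia.
  by move=> z zZ /(connect_trans bl') ?; apply: nZ; exists z.
exists s'; split => //; first by rewrite E1 nths' //; lia.
rewrite E2 last_cat -[in RHS](cat_take_drop j s) last_cat.
case E: (drop j s) => [|? ?] //.
by have := size_drop j s; rewrite E /=; lia.
Qed.

Lemma active_trail_walk x p : active_walk (x :: p) -> uniq (x :: p) ->
  active_trail e Z x (last x p) p.
Proof.
move=> [ap au] up; split.
  split=> //; apply/(pathP x0) => i ip.
  exact: (ap i).
move=> s1 s2 a b c E.
have sE : size (x :: p) = (size s1 + (size s2).+3)%N by rewrite E size_cat /=.
have := au (size s1); rewrite E; rewrite -E sE.
rewrite E !nth_cat ltnn subnn.
rewrite ifF; last by lia.
rewrite ifF; last by lia.
rewrite (_ : (size s1).+1 - size s1 = 1)%N; last by lia.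
rewrite (_ : (size s1).+2 - size s1 = 2)%N; last by lia.
by apply; lia.
Qed.

Lemma walk_active_trail x y p : active_trail e Z x y p ->
  [/\ active_walk (x :: p), uniq (x :: p) & last x p = y].
Proof.
case=> -[/(pathP x0) ap up yl] au; split=> //; split=> [i ip|i]; first exact: ap.
set s := x :: p in au *; move=> ip.
apply: (au (take i s) (drop i.+3 s)).
rewrite -[LHS](cat_take_drop i s); congr (_ ++ _).
by do 3![rewrite (drop_nth x0); last by lia].
Qed.

End ActiveWalk.

(** * The augmented graph and solubility *)

Section Solubility.
Variables (V : finType) (G : influence_diagram V).
Let E := id_arc G.
Let acyc : acyclic E := @arc_acyclic V G.

Lemma aug_connect_inl a y : connect (@aug_arc V G) (inl a) y ->
  exists2 b, y = inl b & connect E a b.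
Proof.
case/connectP=> p; elim: p a => [|[z|z] p IH] a //= => [_ ->|/andP[az zp] yl].
  by exists a.
by have [b -> zb] := IH z zp yl; exists b => //; exact: connect_trans (connect1 az) zb.
Qed.

Lemma connect_aug_inl a b : connect (@aug_arc V G) (inl a) (inl b) = connect E a b.
Proof.
apply/idP/idP => [/aug_connect_inl[_ [<-]]//|/connectP[p]].
elim: p a => [|z p IH] a /= => [_ ->//|/andP[az zp] bl].
by apply: connect_trans (IH _ zp bl); apply: connect1.
Qed.

Lemma aug_acyclic x y : aug_arc x y -> ~~ connect (@aug_arc V G) y x.
Proof.
case: y => [b|]; last by case: x.
move=> xb; apply/negP => /aug_connect_inl[a xa ba]; subst x.
by case/negP: (acyclic_connect acyc xb).
Qed.

Lemma in_aug_set (A : {set V}) a : (inl a \in @aug_set V G A) = (a \in A).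
Proof. by rewrite mem_imset // => ? ? [->]. Qed.

Lemma aug_unblocked_inl (Z : {set V}) a b c :
  unblocked (@aug_arc V G) (aug_set G Z) a (inl b) c <->
  if aug_arc a (inl b) && aug_arc c (inl b)
  then exists2 z, z \in Z & connect E b z else b \notin Z.
Proof.
rewrite /unblocked in_aug_set; case: ifP => // _.
split=> [[_ /imsetP[z zZ ->]]|[z zZ bz]].
  by rewrite connect_aug_inl; exists z.
by exists (inl z); rewrite ?in_aug_set ?connect_aug_inl.
Qed.

Lemma fa_connect v z : z \in fa G v -> connect E z v.
Proof. by rewrite !inE => /orP[/eqP->|/connect1]. Qed.

(** Since repetitions can be removed, any active walk will do; s-reachability is always established
    in this way below. *)
Lemma walk_s_reachable v (u : {w | w \in Va G}) x0 s y :
  active_walk (@aug_arc V G) (aug_set G (fa G v)) x0 (rcons s (inl y)) ->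
  nth x0 (rcons s (inl y)) 0 = inr u -> y \in dsc E v ->
  s_reachable v u.
Proof.
move=> aw hd yv dsep.
have [|s' [aw' us' s'0 E0 El]] := active_walk_uniq aug_acyclic aw.
  by case: (s).
case: s' aw' us' s'0 E0 El => // x p awp up _ /= Ex El.
have tr := active_trail_walk awp up.
move: tr; rewrite El last_rcons Ex hd => tr.
by apply: (dsep _ _ _ _ _ tr); [exact: set11 | rewrite in_aug_set].
Qed.

Lemma active_walk2 (Z : {set V}) x0 (u : {w | w \in Va G}) :
  active_walk (@aug_arc V G) (aug_set G Z) x0 [:: inr u; inl (val u)].
Proof. by split=> [[|i]|i] //= _; rewrite /usym /= eqxx. Qed.

(** The single arc from vartheta_u to [u] has no inner vertex, so nothing can block it. *)
Lemma relevance_dsc v u : v \in Va G -> u \in Va G -> u \in dsc E v ->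
  relevance_arc G v u.
Proof.
move=> vA uA uv; rewrite /relevance_arc vA /=; apply/asboolP.
exists (exist _ u uA) => //.
exact: (@walk_s_reachable _ _ (inl v) [:: _] _
  (@active_walk2 (fa G v) (inl v) (exist _ u uA))).
Qed.

(** From vartheta_u the walk goes through [u] down to [w]. No vertex of [fa v] descends from [u],
    since [v] does not, so the descent is not blocked. *)
Lemma relevance_common_dsc v u w : v \in Va G -> u \in Va G ->
  ~~ connect E u v -> w \in dsc E v -> w \in dsc E u -> relevance_arc G v u.
Proof.
move=> vA uA uv wv /[!inE]/andP[wu cuw].
rewrite /relevance_arc vA /=; apply/asboolP.
exists (exist _ u uA) => //.
have := @active_walk2 (fa G v) (inl v) (exist _ u uA).
move=> /(@active_walk_down _ _ _ _ aug_acyclic [:: _] (inl u) (inl w)) => /=.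
case; rewrite ?connect_aug_inl //.
  move=> _ /imsetP[z zv ->]; rewrite connect_aug_inl.
  by apply: contraNN uv => /connect_trans; apply; apply: fa_connect.
by move=> s aw hd; exact: (walk_s_reachable aw hd).
Qed.

Hypothesis sol : soluble G.

Lemma soluble_asym u v : relevance_arc G u v -> relevance_arc G v u = false.
Proof.
move=> uv; apply/negP => vu.
by have := @sol [:: u; v]; rewrite /= uv vu => /(_ isT).
Qed.

(** Two incomparable decisions with a common descendant would be relevant to each other, a cycle of
    length 2. *)
Lemma soluble_comparable u v w : u \in Va G -> v \in Va G ->
  w \in dsc E u -> w \in dsc E v -> connect E u v || connect E v u.
Proof.
move=> uA vA wu wv; apply: contraT; rewrite negb_or => /andP[nuv nvu].
have vu := relevance_common_dsc vA uA nuv wv wu.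
have uv := relevance_common_dsc uA vA nvu wu wv.
by rewrite (soluble_asym uv) in vu.
Qed.

Section OrderOnDecisions.
Variable leH : rel V.
Hypothesis tH : topological_order (Va G) (relevance_arc G) leH.
Let E' := id_arc' G leH.

Lemma connect_leH u v : u \in Va G -> v \in Va G -> connect E u v -> leH u v.
Proof.
move=> uA vA uv; case: (tH) => rl _ _ _ el.
have [->|nuv] := eqVneq u v; first exact: rl.
have /el : relevance_arc G u v by apply: relevance_dsc; rewrite // inE eq_sym nuv.
by case/(_ uA vA)/andP.
Qed.

Lemma leH_anti u v : u \in Va G -> v \in Va G -> leH u v -> leH v u -> u = v.
Proof. by case: (tH) => _ an _ _ _ uA vA uv vu; apply: an => //; rewrite uv. Qed.

(** Take for [v'] the last decision entered through an added arc, or [v] if there is none. Paths of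
    [G] between decisions go up in [leH] too, so the whole path up to [v'] does. *)
Lemma connect_id_arc' v x : v \in Va G -> connect E' v x ->
  exists v', [/\ v' \in Va G, leH v v' & connect E v' x].
Proof.
move=> vA /connectP[p]; elim/last_ind: p x => [|p y IH] x /=.
  by move=> _ ->; exists v; split=> //; case: (tH) => ->.
rewrite rcons_path last_rcons => /andP[/IH{}IH + ->].
have [v' [v'A vv' v'l]] := IH _ erefl.
case/orP=> [ly|/and4P[lA yA _ ly]].
  by exists v'; split=> //; exact: connect_trans v'l (connect1 ly).
exists y; split=> //.
have tr := let: And5 _ _ tr _ _ := tH in tr.
apply: (tr (last v p)) => //; apply: (tr v') => //.
exact: connect_leH.
Qed.

Lemma id_arc'_connect v v' x : v \in Va G -> v' \in Va G -> leH v v' ->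
  connect E v' x -> connect E' v x.
Proof.
move=> vA v'A vv' v'x; apply: (@connect_trans _ _ v').
  have [->//|nvv'] := eqVneq v v'.
  by apply: connect1; rewrite /E' /id_arc' vA v'A nvv' vv' orbT.
by apply: connect_sub v'x => a b ab; apply: connect1; rewrite /E' /id_arc' /= (_ : id_arc G a b).
Qed.

Lemma topological_id_arc'' :
  exists le, topological_order [set: V] (id_arc'' G leH) le.
Proof.
(* The rank compares [#|D x|] first and then [h x], which is at most [#|V|]. Along an arc of [G],
   [D] does not shrink and [h] increases. Along an added arc, [D] gains [y]; it loses nothing,
   because a decision above [x] in [G'] must precede [y] in [leH], as [x] would otherwise descend
   from [y] in [G']. *)
pose D x := [set v in Va G | connect E' v x].
pose h x := #|[set z | connect E z x]|.
apply: (@topological_order_rank _ _ _ (fun x => #|D x| * #|V|.+1 + h x)%N) => x y.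
have hV z : (h z <= #|V|)%N by exact: max_card.
case/orP=> [xy|/and3P[xs yA nxy]].
  have : (h x < h y)%N by exact: acyclic_height.
  suff : (#|D x| <= #|D y|)%N by nia.
  apply/subset_leq_card/subsetP => v; rewrite !inE => /andP[-> /=].
  by move=> /connect_trans; apply; apply: connect1; rewrite /E' /id_arc' xy.
suff : (#|D x| < #|D y|)%N by have := hV x; nia.
have nyx : ~~ connect E' y x.
  move: nxy; rewrite inE negb_and negbK => /orP[/eqP xy|//].
  by move: xs; rewrite xy !inE yA.
apply: proper_card; apply/properP; split; last first.
  by exists y; rewrite !inE yA ?connect0 ?(negbTE nyx).
apply/subsetP => v; rewrite !inE => /andP[vA vx]; rewrite vA /=.
have [v' [v'A vv' v'x]] := connect_id_arc' vA vx.
case: (tH) => _ _ tr to _.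
have /orP[yv'|v'y] := to _ _ yA v'A.
  by rewrite (id_arc'_connect yA v'A yv' v'x) in nyx.
by apply: (id_arc'_connect vA yA _ (connect0 _ _)); apply: (tr v').
Qed.

End OrderOnDecisions.

Lemma soluble_algorithmB_succeeds : algorithmB_succeeds G.
Proof.
split; last exact: topological_id_arc''.
apply: (@topological_order_rank _ _ _ (fun x => #|[set z | connect (relevance_arc G) z x]|)).
exact: acyclic_height.
Qed.

Section Orders.
Variables leH le : rel V.
Hypothesis tH : topological_order (Va G) (relevance_arc G) leH.
Hypothesis tG : topological_order [set: V] (id_arc'' G leH) le.

Lemma topological_arc : topological_order [set: V] E le.
Proof.
case: tG => rl an tr to el; split=> // x y xV yV xy.
by apply: el; rewrite // /id_arc'' (_ : id_arc G x y).
Qed.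

Let le_anti x y : le x y -> le y x -> x = y.
Proof. by case: tG => _ an _ _ _ xy yx; apply: an; rewrite ?inE ?xy. Qed.

Lemma connect_le x y : connect E x y -> le x y.
Proof. exact: topological_connect topological_arc. Qed.

(** Undirected steps that never go before [v]; [clique_upper] relates this connectivity to the
    cliques of Algorithm A. *)
Definition upper_arc v : rel V := [rel x y | [&& le v x, le v y & usym E x y]].

(** Induction along the path; the delicate step goes from a descendant [d] of [v] back to a parent
    [a] of [d]. If [a] is a decision, it is comparable with [v]. If not, [a] must descend from [v]
    in [G'], as otherwise [G''] would put it before [v]; then comparability applies to [v] and a
    decision [v'] after [v] in [leH] from which [a] descends in [G]. *)
Lemma connect_upper_dsc v w : v \in Va G -> connect (upper_arc v) v w ->
  w \in v |: dsc E v.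
Proof.
move=> vA /connectP[p]; elim/last_ind: p w => [|p a IH] w /=.
  by move=> _ ->; rewrite !inE eqxx.
rewrite rcons_path last_rcons => /andP[/IH{}IH + ->] {w}.
set d := last v p in IH *.
have {}IH : d \in v |: dsc E v by exact: IH.
case/and3P=> _ va /orP[da|ad].
  by rewrite inE (dsc_step acyc IH da) orbT.
move: IH; rewrite in_setU1 => /orP[/eqP dv|dv].
  by rewrite (le_anti va (connect_le _)) ?in_setU1 ?eqxx // -dv connect1.
apply: contraT; rewrite !inE negb_or negb_and negbK => /andP[nav].
rewrite (negbTE nav) /= => nva.
have nav' : ~~ connect E a v.
  by apply: contra nav => /connect_le av; rewrite (le_anti va av).
have da : d \in dsc E a by rewrite (dsc_step acyc _ ad) // !inE eqxx.
have [aA|aA] := boolP (a \in Va G).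
  by have := soluble_comparable aA vA da dv; rewrite (negbTE nav') (negbTE nva).
have : connect (id_arc' G leH) v a.
  apply: contraT => nc; have : id_arc'' G leH a v.
    by rewrite /id_arc'' vA !inE aA (negbTE nc) andbF orbT.
  case: tG => _ _ _ _ el /el.
  rewrite !inE => /(_ isT isT)/andP[_ av].
  by rewrite (le_anti av va) eqxx in nav.
case/(connect_id_arc' tH vA) => v' [v'A vv' v'a].
have dv' : d \in dsc E v'.
  by apply: (dsc_step acyc _ ad); rewrite !inE v'a andbT orbN.
case/orP: (soluble_comparable v'A vA dv' dv) => [v'v|/connect_trans].
  have Ev : v' = v by exact: leH_anti (connect_leH tH _ _ v'v) vv'.
  by rewrite -Ev v'a in nva.
by move=> /(_ _ v'a); rewrite (negbTE nva).
Qed.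

End Orders.

End Solubility.

(** * Algorithm A *)

Section AlgorithmA.
Variables (V : finType) (G : influence_diagram V) (le : rel V).
Notation E := (id_arc G).
Hypothesis tG : topological_order [set: V] E le.

Let le_refl x : le x x. Proof. by case: tG => /(_ x (in_setT _)). Qed.
Let le_anti x y : le x y -> le y x -> x = y.
Proof. by case: tG => _ an _ _ _ xy yx; apply: an; rewrite ?inE ?xy. Qed.
Let le_trans y x z : le x y -> le y z -> le x z.
Proof. by case: tG => _ _ tr _ _; apply: tr; rewrite inE. Qed.
Let le_total x y : le x y || le y x.
Proof. by case: tG => _ _ _ to _; apply: to; rewrite inE. Qed.
Let le_arc x y : E x y -> le x y.
Proof.
by move=> xy; case: tG => _ _ _ _ el; case/andP: (el x y (in_setT _) (in_setT _) xy).
Qed.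

Implicit Types A : {set V}.

Definition is_last A u := (u \in A) && [forall x in A, le x u].

Lemma is_lastP A u : reflect (u \in A /\ {in A, forall x, le x u}) (is_last A u).
Proof.
apply: (iffP andP) => -[uA H]; split=> //; first by move=> x xA; move/forall_inP: H => ->.
exact/forall_inP.
Qed.

Lemma is_last_uniq A u u' : is_last A u -> is_last A u' -> u = u'.
Proof. by move=> /is_lastP[uA H] /is_lastP[u'A H']; apply: le_anti; [exact: H' | exact: H]. Qed.

Lemma exists_last A : A != set0 -> exists u, is_last A u.
Proof.
case/set0Pn => x0 x0A.
case: (arg_maxnP (fun x => #|[set y | le y x]|) x0A) => u uA umax.
exists u; apply/is_lastP; split=> // x xA.
have /orP[//|ux] := le_total x u.
have : [set y | le y u] == [set y | le y x].
  rewrite eqEcard [X in _ && X](umax x xA) andbT; apply/subsetP => y; rewrite !inE => yu.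
  exact: le_trans yu ux.
by move/eqP/setP/(_ x); rewrite !inE le_refl.
Qed.

Definition algA_invariant (p : seq V) (st : algA_state V) : Prop :=
  [/\ forall v x, v \in p -> x \in st.1 v <-> x \in fa G v \/
        exists w, [/\ (v, w) \in st.2, x \in st.1 w & x != w],
      forall u w, (u, w) \in st.2 = (w \in p) && is_last (st.1 w :\ w) u
    & forall v x, v \in p -> x \in st.1 v -> le x v].

(** The arc added for [v] starts at an element of [Cv] other than [v], hence strictly before [v], so
    the equations of the cliques already computed are not disturbed. *)
Lemma algA_invariant_step p st v : algA_invariant p st ->
  v \notin p -> {in p, forall w, le v w} ->
  algA_invariant (rcons p v) (algA_step G le st v).
Proof.
move=> [i1 i2 i3] vp pv.
set Cv := fa G v :|: \bigcup_(w | (v, w) \in st.2) (st.1 w :\ w).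
have wv w : w \in p -> (w == v) = false by move=> wp; apply: contraNF vp => /eqP <-.
have CvP x : x \in Cv <-> x \in fa G v \/
    exists w, [/\ (v, w) \in st.2, x \in st.1 w & x != w].
  rewrite inE; split=> [/orP[->|/bigcupP[w vw]]|[->//|[w [vw xw nxw]]]]; first by left.
    by rewrite in_setD1 => /andP[nxw xw]; right; exists w.
  by apply/orP; right; apply/bigcupP; exists w; rewrite // in_setD1 nxw.
have Cvle x : x \in Cv -> le x v.
  case/CvP => [|[w [+ xw nxw]]].
    by rewrite !inE => /orP[/eqP->|/le_arc].
  by rewrite i2 => /andP[_ /is_lastP[_]]; apply; rewrite in_setD1 nxw.
have E1 w : (algA_step G le st v).1 w = if w == v then Cv else st.1 w by rewrite ffunE.
have E2 u w : (u, w) \in (algA_step G le st v).2 =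
    (((w == v) && is_last (Cv :\ v) u) || ((u, w) \in st.2)).
  rewrite /algA_step /= -/Cv; case: pickP => [u0 u0P|noP].
    rewrite !inE xpair_eqE; congr (_ || _); rewrite andbC; congr (_ && _).
    apply/eqP/idP => [->//|/is_last_uniq]; apply; exact: u0P.
  by rewrite [is_last _ u]noP andbF.
have ne2 u w : (u, w) \in st.2 -> (w == v) = false by rewrite i2 => /andP[/wv].
split=> [w x|u w|w x].
- rewrite mem_rcons inE E1 => /orP[/eqP->|wp].
    rewrite eqxx CvP; split=> -[->|[w' [vw' xw' nxw']]]; try (by left); right; exists w'.
      by rewrite E2 vw' orbT E1 (ne2 _ _ vw').
    move: vw' xw'; rewrite E2 => /orP[/andP[_ /is_lastP[]]|vw'].
      by rewrite !inE eqxx.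
    by rewrite E1 (ne2 _ _ vw').
  rewrite wv // i1 //; split=> -[->|[w' [vw' xw' nxw']]]; try (by left); right; exists w'.
    by rewrite E2 vw' orbT E1 (ne2 _ _ vw').
  move: vw' xw'; rewrite E2 => /orP[/andP[_ /is_lastP[]]|vw'].
    rewrite in_setD1 => /andP[nwv wC]; have ewv := le_anti (Cvle _ wC) (pv _ wp).
    by rewrite ewv eqxx in nwv.
  by rewrite E1 (ne2 _ _ vw').
- rewrite E2 E1 mem_rcons inE i2; case: eqVneq => [->|_] //=.
  by rewrite (negbTE vp) orbF.
rewrite mem_rcons inE E1; case: eqVneq => [-> _|_ /= wp]; first exact: Cvle.
exact: i3.
Qed.

Let out := algorithmA G le.

Lemma algorithmA_invariant : algA_invariant (rev (sort le (enum V))) out.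
Proof.
rewrite /out /algorithmA.
have : pairwise (fun x y => le y x) (rev (sort le (enum V))).
  rewrite -sorted_pairwise => [|y x z /= yx zy]; last exact: le_trans zy yx.
  rewrite rev_sorted; exact: sort_sorted.
have : uniq (rev (sort le (enum V))) by rewrite rev_uniq sort_uniq enum_uniq.
elim/last_ind: (rev _) => [|s v IH].
  by move=> _ _; split=> // u w; rewrite inE.
rewrite rcons_uniq pairwise_rcons foldl_rcons => /andP[vs us] /andP[/allP sv ps].
by apply: algA_invariant_step => //; exact: IH.
Qed.

Let in_processed v : v \in rev (sort le (enum V)).
Proof. by rewrite mem_rev mem_sort mem_enum. Qed.

Notation Cl := (out.1).

Definition tree_parent : rel V := fun u w => (u, w) \in out.2.

Lemma tree_parentE u w : tree_parent u w = is_last (Cl w :\ w) u.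
Proof. by case: algorithmA_invariant => _ i2 _; rewrite /tree_parent i2 in_processed. Qed.

Lemma in_cliqueP v x : x \in Cl v <-> x \in fa G v \/
  exists w, [/\ tree_parent v w, x \in Cl w & x != w].
Proof. by case: algorithmA_invariant => i1 _ _; exact: i1. Qed.

Lemma clique_le v x : x \in Cl v -> le x v.
Proof. by case: algorithmA_invariant => _ _ i3; exact: i3. Qed.

Lemma fa_clique v : fa G v \subset Cl v.
Proof. by apply/subsetP => x xv; apply/in_cliqueP; left. Qed.

Lemma self_clique v : v \in Cl v.
Proof. by apply: (subsetP (fa_clique v)); rewrite !inE eqxx. Qed.

Lemma clique_inj : injective (fun v => Cl v).
Proof.
move=> u v uv; apply: le_anti; apply: clique_le.
  by rewrite -uv self_clique.
by rewrite uv self_clique.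
Qed.

Lemma tree_parent_uniq u u' w : tree_parent u w -> tree_parent u' w -> u = u'.
Proof. by rewrite !tree_parentE; exact: is_last_uniq. Qed.

Lemma tree_parent_in u w : tree_parent u w -> u \in Cl w.
Proof. by rewrite tree_parentE => /is_lastP[]; rewrite in_setD1 => /andP[]. Qed.

Lemma tree_parent_neq u w : tree_parent u w -> u != w.
Proof. by rewrite tree_parentE => /is_lastP[]; rewrite in_setD1 => /andP[]. Qed.

Lemma tree_parent_le u w : tree_parent u w -> le u w.
Proof. by move=> /tree_parent_in/clique_le. Qed.

Lemma tree_parent_ngt u w : tree_parent u w -> ~~ le w u.
Proof.
move=> uw; apply/negP => wu; have := tree_parent_neq uw.
by rewrite (le_anti (tree_parent_le uw) wu) eqxx.
Qed.

Lemma tree_parent_sub u w x : tree_parent u w -> x \in Cl w -> x != w -> x \in Cl u.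
Proof. by move=> uw xw nxw; apply/in_cliqueP; right; exists w. Qed.

Lemma tree_parent_ex w x : x \in Cl w -> x != w -> exists u, tree_parent u w.
Proof.
move=> xw nxw; have [|u uP] := @exists_last (Cl w :\ w).
  by apply/set0Pn; exists x; rewrite in_setD1 nxw.
by exists u; rewrite tree_parentE.
Qed.

Lemma tree_parent_nin u w : tree_parent u w -> w \notin Cl u.
Proof. by move=> /tree_parent_ngt; apply: contra; exact: clique_le. Qed.

(** The position of [v] in the order [le], not its depth in the tree; it increases along tree
    arcs. *)
Definition height v := #|[set w | le w v]|.

Lemma height_lt u w : le u w -> u != w -> (height u < height w)%N.
Proof.
move=> uw nuw; apply: proper_card; apply/properP; split.
  by apply/subsetP => x; rewrite !inE => /le_trans; exact.
exists w; rewrite !inE ?le_refl //; apply: contraNN nuw => wu.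
by rewrite (le_anti uw wu).
Qed.

Lemma tree_parent_height u w : tree_parent u w -> (height u < height w)%N.
Proof. by move=> uw; apply: height_lt; [exact: tree_parent_le | exact: tree_parent_neq]. Qed.

Lemma tree_connect_le u w : connect tree_parent u w -> le u w.
Proof.
case/connectP=> p; elim: p u => [|x p IH] u /= => [_ ->//|/andP[ux xp] /(IH _ xp)].
exact: le_trans (tree_parent_le ux).
Qed.

(** Going up from [w] to successive tree parents keeps [x] in the clique until [x] itself is
    reached. *)
Lemma clique_connect x w : x \in Cl w -> connect tree_parent x w.
Proof.
have [k] := ubnP (height w); elim: k w => // k IH w /ltnSE hw xw.
have [->//|nxw] := eqVneq x w.
have [u uw] := tree_parent_ex xw nxw.
apply: connect_trans (connect1 uw); apply: IH.
  exact: leq_trans (tree_parent_height uw) hw.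
exact: tree_parent_sub uw xw nxw.
Qed.

(** If [x] comes from a child [w] of [v] in the tree, then both [x] and [v] lie in the clique of
    [w]. By induction they belong to the families of vertices [w1] and [w2] connected to [w], and
    the path runs from [v] through [w2] and [w] to [w1]. It stays above [v] because [v] is before
    [w]. *)
Lemma clique_upper v x : x \in Cl v ->
  exists2 w, x \in fa G w & connect (upper_arc G le v) v w.
Proof.
have [k] := ubnP (#|V| - height v); elim: k v x => // k IH v x /ltnSE hv.
case/in_cliqueP => [xv|[w [vw xw nxw]]]; first by exists v.
have hw : (#|V| - height w < k)%N.
  have := tree_parent_height vw; have : (height w <= #|V|)%N by exact: max_card.
  by move: hv; lia.
have [w1 xw1 ww1] := IH w x hw xw.
have [w2 vw2 ww2] := IH w v hw (tree_parent_in vw).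
have sub y : connect (upper_arc G le w) w y ->
    connect (upper_arc G le v) w y /\ connect (upper_arc G le v) y w.
  move=> wy; have : connect (upper_arc G le v) w y.
    apply: connect_sub wy => a b /and3P[wa wb ab]; apply: connect1.
    have vw' := tree_parent_le vw.
    by apply/and3P; split; [exact: le_trans vw' wa | exact: le_trans vw' wb | ].
  split=> //; rewrite sym_connect_sym // => a b.
  by rewrite /upper_arc /usym /= andbCA orbC.
exists w1 => //.
apply: connect_trans (sub _ ww1).1; apply: connect_trans (sub _ ww2).2.
move: vw2; rewrite !inE => /orP[/eqP->//|vw2]; apply: connect1.
by rewrite /upper_arc /usym /= le_refl le_arc // (vw2 : id_arc G v w2).
Qed.

End AlgorithmA.

(** * The output of Algorithm A as a rooted junction tree *)

Lemma usym_sym (T : finType) (e : rel T) : symmetric (usym e).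
Proof. by move=> x y; rewrite /usym /= orbC. Qed.

Section Tree.
Variables (V : finType) (G : influence_diagram V) (le : rel V).
Notation E := (id_arc G).
Hypothesis tG : topological_order [set: V] E le.
Let out := algorithmA G le.
Notation Cl := (out.1).
Notation par := (tree_parent G le).

Let le_anti x y : le x y -> le y x -> x = y.
Proof. by case: tG => _ an _ _ _ xy yx; apply: an; rewrite ?inE ?xy. Qed.
Let le_trans y x z : le x y -> le y z -> le x z.
Proof. by case: tG => _ _ tr _ _; apply: tr; rewrite inE. Qed.

(** As tree parents are unique, a step up right after a step down would return to the previous
    vertex. *)
Lemma descending_path x y p : par x y -> path (usym par) y p ->
  uniq [:: x, y & p] -> path par x (y :: p).
Proof.
elim: p x y => [|z p IH] x y xy /=; first by rewrite xy.
case/andP=> yz zp /and3P[xn yn up]; rewrite xy /=.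
have {}yz : par y z.
  case/orP: yz => // zy; move: xn.
  by rewrite (tree_parent_uniq tG xy zy) !inE eqxx orbT.
by apply: (IH y z) => //; rewrite /= yn.
Qed.

Lemma path_par_connect x p : path par x p -> connect par x (last x p).
Proof. by move=> xp; apply/connectP; exists p. Qed.

(* A simple path cannot turn back after a downward step, hence it can be shortened
   at one of its ends without losing the vertices whose clique contains [x]. *)
Lemma clique_path x u p : path (usym par) u p -> uniq (u :: p) ->
  x \in Cl u -> x \in Cl (last u p) -> {in u :: p, forall w, x \in Cl w}.
Proof.
have [n] := ubnP (size p); elim: n u p => // n IH u p /ltnSE sp.
case: p sp => [|y p] sp up uq xu xl w; first by rewrite inE => /eqP->.
have [/andP[yu nxu]|nyu] := boolP (par y u && (x != u)).
  rewrite inE => /orP[/eqP->//|wp].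
  case/andP: up => _ yp; case/andP: uq => _ uqp.
  exact: (IH y p sp yp uqp (tree_parent_sub tG yu xu nxu) xl).
pose q := belast y p; pose l := last y p; have Ep : y :: p = rcons q l by exact: lastI.
have lu : l != u.
  by apply: contraTneq uq => lu; rewrite /= -lu mem_last.
have [/andP[ql nxl]|nql] := boolP (par (last u q) l && (x != l)).
  move: sp up uq xl; rewrite Ep size_rcons rcons_path last_rcons -rcons_cons rcons_uniq.
  move=> sp /andP[uq _] /andP[_ uqq] xl.
  rewrite mem_rcons inE => /orP[/eqP->//|wq].
  exact: (IH u q sp uq uqq xu (tree_parent_sub tG ql xl nxl) w wq).
exfalso; have xlel : le x l by exact: (clique_le tG xl).
have xleu : le x u by exact: (clique_le tG xu).
have [yu|yu] := boolP (par y u).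
  have xu' : x = u by apply/eqP; move: nyu; rewrite yu negbK.
  have lql : par l (last u q).
    move: up; rewrite Ep rcons_path => /andP[_ /orP[ql|//]].
    by move: nql; rewrite ql xu' eq_sym lu.
  have : path (usym par) l (rev (u :: q)).
    rewrite (rev_path (usym par) u (y :: p)).
    by rewrite (eq_path (e' := usym par)) // => a b; rewrite usym_sym.
  have ulq : uniq (l :: rev (u :: q)).
    by rewrite -rev_rcons rev_uniq rcons_cons -Ep.
  have Er : rev (u :: q) = last u q :: rev (belast u q) by rewrite lastI rev_rcons.
  rewrite Er in ulq *; case/andP=> _ lp.
  have /path_par_connect := descending_path lql lp ulq.
  rewrite -Er rev_cons last_rcons => lcu.
  have := tree_connect_le tG lcu.
  by rewrite -xu' => lx; have := le_anti lx xlel; rewrite xu' => /eqP; rewrite (negbTE lu).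
have uy : par u y by case/andP: up => /orP[//|]; rewrite (negbTE yu).
case/andP: up => _ yp; have dp := descending_path uy yp uq.
have xl' : x = l.
  apply/eqP; move: dp nql; rewrite Ep rcons_path => /andP[_ ->].
  by rewrite negbK.
have := tree_connect_le tG (path_par_connect dp); rewrite /= -/l -xl' => ux.
by move: lu; rewrite -xl' (le_anti ux xleu) eqxx.
Qed.

(** At a vertex of the cycle that is last for [le], both neighbours are its tree parent, hence
    equal. *)
Lemma tree_cycle c : ucycle (usym par) c -> (size c <= 2)%N.
Proof.
case: c => // x0 c0; set c := x0 :: c0 => /andP[cc uc].
have x0c : x0 \in c by rewrite inE eqxx.
case: (arg_maxnP (height le) x0c) => x xc xmax.
have up a b : usym par a b -> (height le b <= height le a)%N -> par b a.
  by case/orP=> // /(tree_parent_height tG); rewrite ltnNge => /negbTE->.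
have [i p Ep] := rot_to xc.
have cc' : cycle (usym par) (x :: p) by rewrite -Ep rot_cycle.
have uc' : uniq (x :: p) by rewrite -Ep rot_uniq.
have xm a : a \in x :: p -> (height le a <= height le x)%N by rewrite -Ep mem_rot => /xmax.
rewrite -(size_rot i) Ep; case: p {Ep} cc' uc' xm => // y p.
rewrite /= rcons_path => /and3P[xy yp lx] /and3P[_ yn _] xm.
have px : par y x by apply: up => //; apply: xm; rewrite !inE eqxx orbT.
have lx' : par (last y p) x.
  by apply: up; [rewrite usym_sym | apply: xm; rewrite inE mem_last orbT].
have Ey := tree_parent_uniq tG px lx'.
by case: p Ey yn {yp lx lx' xm} => //= z p ->; rewrite mem_last.
Qed.


Definition is_root r := Cl r :\ r == set0.

Lemma exists_root v : exists2 r, is_root r & connect par r v.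
Proof.
have [k] := ubnP (height le v); elim: k v => // k IH v /ltnSE hv.
have [rv|/set0Pn[x]] := boolP (is_root v); first by exists v.
rewrite in_setD1 => /andP[nxv xv]; have [u uv] := tree_parent_ex tG xv nxv.
have [|r rr ru] := IH u; first exact: leq_trans (tree_parent_height tG uv) hv.
by exists r => //; exact: connect_trans ru (connect1 uv).
Qed.

Lemma root_connect r x : is_root r -> connect par x r -> x = r.
Proof.
move=> /eqP r0 /connectP[p]; case/lastP: p => [|p y]; first by move=> _ ->.
rewrite rcons_path last_rcons => /andP[_ +] ry.
by rewrite -ry tree_parentE // => /is_lastP[]; rewrite r0 inE.
Qed.

Lemma connect_parent u w v : par u w -> connect par v w -> v != w -> connect par v u.
Proof.
move=> uw /connectP[p]; case/lastP: p => [|p y]; first by move=> _ ->; rewrite eqxx.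
rewrite rcons_path last_rcons => /andP[vp ly] wy _; rewrite -wy in ly.
by rewrite (tree_parent_uniq tG uw ly); exact: path_par_connect.
Qed.

Lemma root_uniq r r' v : is_root r -> is_root r' ->
  connect par r v -> connect par r' v -> r = r'.
Proof.
move=> rr rr'; have [k] := ubnP (height le v); elim: k v => // k IH v /ltnSE hv rv r'v.
have [rE|nrv] := eqVneq r v.
  by apply/esym; apply: root_connect rr _; rewrite rE.
have [rE|nr'v] := eqVneq r' v; first by apply: root_connect rr' _; rewrite rE.
have [u uv] : exists u, par u v.
  case/connectP: rv => p; case/lastP: p => [|p y].
    by move=> _ vr; rewrite vr eqxx in nrv.
  by rewrite rcons_path last_rcons => /andP[_ ly] ->; exists (last r p).
apply: (IH u); last 2 first; try exact: connect_parent uv _ _.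
exact: leq_trans (tree_parent_height tG uv) hv.
Qed.

Lemma clique_component x w : x \in Cl w -> connect (usym E) w x.
Proof.
case/(clique_upper tG) => v xv wv; apply: (@connect_trans _ _ v).
  by apply: connect_sub wv => a b /and3P[_ _ ab]; exact: connect1.
by move: xv; rewrite !inE => /orP[/eqP->//|xv]; apply: connect1; rewrite /usym /= (xv : id_arc G x v) orbT.
Qed.

(** The tail of an arc of [G] lies in the clique of the head, so it is an ancestor of the head in
    the tree; a weak component thus has a single root. *)
Lemma root_usym r u v : is_root r -> connect (usym E) u v -> connect par r u ->
  connect par r v.
Proof.
move=> rr /connectP[p]; elim: p u => [|w p IH] u /= => [_ ->//|/andP[uw wp] vl ru].
apply: IH wp vl _; case/orP: uw => [uw|wu].
  apply: connect_trans ru (clique_connect tG _).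
  by apply: (subsetP (fa_clique tG w)); rewrite !inE (uw : id_arc G u w) orbT.
have [r' rr' r'w] := exists_root w.
have wu' : connect par w u.
  apply: (clique_connect tG).
  by apply: (subsetP (fa_clique tG u)); rewrite !inE (wu : id_arc G w u) orbT.
by rewrite (root_uniq rr rr' ru (connect_trans r'w wu')).
Qed.

Let arc : rel {set V} := out_arc out.

Lemma out_arcP C D : reflect (exists u w, [/\ C = Cl u, D = Cl w & par u w]) (arc C D).
Proof.
apply: (iffP existsP) => [[[u w] /and3P[uw /eqP-> /eqP->]]|[u [w [-> -> uw]]]].
  by exists u, w.
by exists (u, w); rewrite !eqxx (uw : (u, w) \in out.2).
Qed.

Lemma out_arcE u w : arc (Cl u) (Cl w) = par u w.
Proof.
apply/out_arcP/idP => [[u' [w' []]]|uw]; last by exists u, w.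
by move=> /(clique_inj tG)-> /(clique_inj tG)->.
Qed.

(** Stated for an arbitrary set of cliques closed under tree parents, to serve both for the whole
    output and for one weak component. *)
Lemma root_clique_vertex (N : {set {set V}}) (b : rel {set V}) v :
  (forall u w, Cl w \in N -> par u w -> (Cl u \in N) && b (Cl u) (Cl w)) ->
  (forall C, C \in N -> exists u, C = Cl u) ->
  Cl v \in N -> root_clique N b v (Cl v).
Proof.
move=> Npar NCl vN; split; first by rewrite inE vN self_clique.
move=> D; rewrite inE => /andP[DN vD]; have [w Dw] := NCl D DN; rewrite {}Dw in DN vD *.
have [k] := ubnP (height le w); elim: k w DN vD => // k IH w wN vw /ltnSE hw.
have [->//|nvw] := eqVneq v w.
have [u uw] := tree_parent_ex tG vw nvw.
have vu := tree_parent_sub tG uw vw nvw.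
have /andP[uN buw] := Npar _ _ wN uw.
apply: connect_trans (IH u uN vu (leq_trans (tree_parent_height tG uw) hw)) (connect1 _).
by rewrite /subrel_on /= !inE uN wN vu vw.
Qed.

Lemma root_cliqueE u v : root_clique (out_nodes out) arc u (Cl v) <-> u = v.
Proof.
have inN w : Cl w \in out_nodes out by apply/imsetP; exists w.
split=> [[+ H]|->]; last first.
  apply: root_clique_vertex => //; last by move=> C /imsetP[w _ ->]; exists w.
  by move=> a b _ ab; rewrite inN out_arcE.
rewrite inE => /andP[_ uv].
have : Cl u \in [set D in out_nodes out | u \in D] by rewrite inE inN self_clique.
move=> /H vu; apply: le_anti (clique_le tG uv) _.
have [p] := connectP vu; move=> {vu}; elim: p v {uv H} => [|C p IH] v /=.
  by move=> _ /(clique_inj tG)->; case: tG => ->.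
case/andP=> /and3P[_ _ /out_arcP[a [b [/(clique_inj tG)-> -> ab]]]] bp ul.
exact: le_trans (tree_parent_le tG ab) (IH b bp ul).
Qed.

Section Component.
Variable K : {set V}.
Hypothesis K_component : {in K, forall v w, (w \in K) = connect (usym E) v w}.
Variable v0 : V.
Hypothesis v0K : v0 \in K.

Let N : {set {set V}} := [set Cl v | v in K].
Let e := subrel_on N arc.

Let inN v : (Cl v \in N) = (v \in K).
Proof. by rewrite mem_imset //; exact: clique_inj. Qed.

Let par_K u w : w \in K -> par u w -> u \in K.
Proof. by move=> wK uw; rewrite (K_component wK); apply/clique_component/tree_parent_in. Qed.

Let eE u w : e (Cl u) (Cl w) = [&& u \in K, w \in K & par u w].
Proof. by rewrite /e /subrel_on /= !inN out_arcE. Qed.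

Let usym_e u D : usym e (Cl u) D -> exists2 w, D = Cl w & usym par u w.
Proof.
have nodeP C : C \in N -> exists w, C = Cl w by case/imsetP=> w _ ->; exists w.
move=> H; have [w Dw] : exists w, D = Cl w.
  by apply: nodeP; case/orP: H => /and3P[].
exists w => //; move: H; rewrite Dw /usym /= !eE.
by case/orP=> /and3P[_ _ ->]; rewrite ?orbT.
Qed.

Let path_e u p : path (usym e) (Cl u) p ->
  exists2 q, p = map (fun w => Cl w) q & path (usym par) u q.
Proof.
elim: p u => [|D p IH] u /=; first by exists [::].
case/andP=> /usym_e[w -> uw] /IH[q -> wq].
by exists (w :: q) => //=; rewrite uw.
Qed.

Let connect_e u w : w \in K -> connect par u w -> connect e (Cl u) (Cl w).
Proof.
move=> wK /connectP[p]; elim/last_ind: p w wK => [|p y IH] w wK; first by move=> _ ->.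
rewrite rcons_path last_rcons => /andP[up ly] wy; subst y.
have lK := par_K wK ly; apply: connect_trans (IH _ lK up erefl) (connect1 _).
by rewrite eE lK wK.
Qed.

Lemma component_is_tree : is_tree N (usym e).
Proof.
split.
- by apply/set0Pn; exists (Cl v0); rewrite inN.
- split; first exact: usym_sym.
  move=> C; rewrite /usym /= orbb; apply/negP => /and3P[_ _ /out_arcP[u [w [-> /(clique_inj tG)-> ww]]]].
  by have := tree_parent_neq tG ww; rewrite eqxx.
- by move=> C D /orP[] /and3P[-> ->].
- have [r rr rv0] := exists_root v0.
  have rC C : C \in N -> connect (usym e) (Cl r) C.
    case/imsetP=> w wK ->.
    have : connect e (Cl r) (Cl w).
      by apply: connect_e => //; apply: root_usym rr _ rv0; rewrite -(K_component v0K).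
    by apply: connect_sub => a b ab; apply: connect1; rewrite /usym /= ab.
  move=> C D CN DN; apply: (@connect_trans _ _ (Cl r)); last exact: rC.
  by rewrite sym_connect_sym; [exact: rC | exact: usym_sym].
case=> // C c /andP[cc uc].
have [u Cu] : exists u, C = Cl u.
  have : usym e C (head C (rcons c C)) by case: (c) cc => [|? ?] /= /andP[].
  by case/orP=> /and3P[/imsetP[u _ ->] /imsetP[w _ ->]] _; [exists u | exists w].
rewrite /cycle Cu in cc; rewrite Cu in uc; have [q Eq uq] := path_e cc.
case/lastP: q Eq uq => [|q w]; first by case: (c).
rewrite map_rcons => /rcons_inj[Ec /(clique_inj tG) uw] uq; subst w c.
rewrite /= size_map; apply: (@tree_cycle (u :: q)); rewrite /ucycle /cycle uq /=.
by move: uc; rewrite -map_cons map_inj_uniq //; exact: clique_inj.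
Qed.

Lemma component_junction_tree : junction_tree_on G K N (usym e).
Proof.
split.
- exact: component_is_tree.
- move=> C /imsetP[w wK ->]; apply/subsetP => x xw.
  by rewrite (K_component wK) clique_component.
- by move=> v vK; exists (Cl v); rewrite ?inN // fa_clique.
move=> C D /imsetP[u uK ->] DN p [up uq pl] C' C'p; apply/subsetP => x.
rewrite inE => /andP[xu xD].
have [q Ep uq'] := path_e up; rewrite Ep in C'p uq pl.
have lq : last (Cl u) (map (fun w => Cl w) q) = Cl (last u q) by rewrite (last_map (fun w => Cl w)).
rewrite lq in pl; rewrite -pl in xD.
have uqq : uniq (u :: q).
  by move: uq; rewrite -(map_cons (fun w => Cl w)) map_inj_uniq //; exact: clique_inj.
move: C'p; rewrite -(map_cons (fun w => Cl w)) => /mapP[w wq ->].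
exact: clique_path uq' uqq xu xD w wq.
Qed.

Lemma component_rooted : exists r, is_rooted_tree N e r.
Proof.
have [r rr rv0] := exists_root v0.
exists (Cl r); split.
- exact: component_is_tree.
- move=> C D /and3P[_ _ /out_arcP[u [w [-> -> uw]]]]; rewrite eE.
  apply/negP => /and3P[_ _ /(tree_parent_le tG)].
  by apply/negP; exact: tree_parent_ngt uw.
- rewrite inN; case/connectP: rv0 => p; elim/last_ind: p v0 v0K => [|p y IH] w wK.
    by move=> _ /= <-.
  rewrite rcons_path last_rcons => /andP[rp ly] wy; subst y.
  exact: IH (par_K wK ly) rp erefl.
move=> C /imsetP[w wK ->]; apply: connect_e => //.
by apply: root_usym rr _ rv0; rewrite -(K_component v0K).
Qed.

Lemma component_rooted_junction_tree : rooted_junction_tree_on G K N e.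
Proof.
split; [exact: component_rooted | exact: component_junction_tree |].
move=> v vK; exists (Cl v); last exact: fa_clique.
apply: root_clique_vertex; rewrite ?inN //.
  by move=> u w; rewrite !inN eE => wK uw; rewrite (par_K wK uw) wK.
by move=> C /imsetP[u _ ->]; exists u.
Qed.

End Component.

Lemma algorithmA_rooted_junction_tree : rooted_junction_tree G (out_nodes out) arc.
Proof.
have eqR : {in [set: V] & &, equivalence_rel (connect (usym E))}.
  move=> x y z _ _ _; split; first exact: connect0.
  have sym := sym_connect_sym (@usym_sym V E).
  move=> xy; apply/idP/idP; last exact: connect_trans.
  by apply: connect_trans; rewrite sym.
have Kcomp K : K \in weak_components G ->
    {in K, forall v w, (w \in K) = connect (usym E) v w}.
  case/imsetP=> x _ -> v; rewrite !inE => xv w; rewrite !inE.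
  by have [_ ->] := eqR x v w (in_setT _) (in_setT _) (in_setT _).
have Kne K : K \in weak_components G -> exists v, v \in K.
  by case/imsetP=> x _ ->; exists x; rewrite !inE connect0.
have Kof v : exists2 K, K \in weak_components G & v \in K.
  exists [set w in [set: V] | connect (usym E) v w].
    by apply/imsetP; exists v.
  by rewrite !inE connect0.
exists (fun K : {set V} => [set Cl v | v in K]); split.
- apply/setP => C; apply/imsetP/bigcupP => [[v _ ->]|[K _ /imsetP[v _ ->]]]; last by exists v.
  by have [K Kw vK] := Kof v; exists K => //; apply/imsetP; exists v.
- move=> K L KW LW; apply: contraNT => /pred0Pn[C /andP[/= /imsetP[v vK ->] /imsetP[w wL]]].
  move=> /(clique_inj tG) vw; rewrite -vw in wL.
  by apply/eqP/setP => x; rewrite (Kcomp K KW v vK) (Kcomp L LW v wL).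
- move=> C D /out_arcP[u [w [-> -> uw]]]; have [K KW wK] := Kof w.
  exists K => //; apply/andP; split; apply/imsetP; last by exists w.
  by exists u => //; rewrite (Kcomp K KW w wK); apply/clique_component/tree_parent_in.
move=> K KW; have [v vK] := Kne K KW.
exact: component_rooted_junction_tree (Kcomp K KW) v vK.
Qed.

End Tree.

(** * Non-convexity *)

Section NotSoluble.
Variables (V : finType) (G : influence_diagram V).
Notation E := (id_arc G).
Let acyc : acyclic E := @arc_acyclic V G.

(* A trail from [vartheta_(t 0)] through [t 0], ..., [t n] to a descendant [t n.+1]
   of [v] that is active given [fa v]. The edge [i] joins [t i.-1] and [t i]
   ([vartheta_(t 0)] and [t 0] if [i = 0]); [fwd i] says that it points towards
   [t i]. *)
Record relevant_trail (v : V) (n : nat) (t : nat -> V) (fwd : nat -> bool) : Prop :=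
  RelevantTrail {
    trail_start : t 0%N \in Va G;
    trail_edge : forall i, (i <= n)%N ->
      if fwd i.+1 then E (t i) (t i.+1) else E (t i.+1) (t i);
    trail_fwd0 : fwd 0%N;
    trail_fwdn : fwd n.+1;
    trail_last : t n.+1 \in dsc E v;
    trail_inner : forall i, (i <= n)%N -> t i \notin v |: dsc E v;
    trail_inj : forall i j, (i <= n)%N -> (j <= n)%N -> t i = t j -> i = j;
    trail_active : forall i, (i <= n)%N ->
      if fwd i && ~~ fwd i.+1 then connect E (t i) v else t i \notin fa G v
  }.

(** If all relevance arcs led to descendants, the number of ancestors in [G] would increase along a
    cycle of them. *)
Lemma not_soluble_arc : ~ soluble G ->
  exists v u, relevance_arc G v u /\ u \notin dsc E v.
Proof.
move=> nsol; apply: contrapT => H; apply: nsol.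
pose h x := #|[set z | connect E z x]|.
have hR v u : relevance_arc G v u -> (h v < h u)%N.
  move=> vu; have : u \in dsc E v.
    by apply: contraT => nd; exfalso; apply: H; exists v, u.
  rewrite inE => /(connect_neqP acyc)[w vw wu].
  apply: leq_trans (acyclic_height acyc vw) _.
  apply/subset_leq_card/subsetP => x; rewrite !inE => /connect_trans; exact.
have hp p x : path (relevance_arc G) x p -> p != [::] -> (h x < h (last x p))%N.
  elim: p x => // y p IH x /= /andP[/hR xy yp] _.
  case: p IH yp => // z p IH yp; exact: ltn_trans xy (IH y yp isT).
case=> // x p /hp; rewrite last_rcons ltnn => H'.
by have : false by apply: H'; case: (p).
Qed.

(** The d-connecting trail is cut at its first descendant of [v]. Its last arc then points forwards,
    since otherwise the previous vertex would already be a descendant of [v]. *)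
Lemma relevance_trail v u : relevance_arc G v u -> u \notin dsc E v ->
  exists n t fwd, t 0%N = u /\ relevant_trail v n t fwd.
Proof.
case/andP=> vA /asboolP[w <-]; rewrite /s_reachable => nsep nwv.
have [y [p [yv]]] : exists y p, y \in dsc E v /\
    active_trail (@aug_arc V G) (aug_set G (fa G v)) (inr w) (inl y) p.
  apply: contrapT => H; apply: nsep => x y p; rewrite in_set1 => /eqP-> /imsetP[y' yv ->] tr.
  by apply: H; exists y', p.
case/(walk_active_trail (inl v)); set s := inr w :: p => -[ap au] us ls.
pose a i := nth (inl v) s i.
(* Position 0 is occupied by vartheta_u, whence the shift by one. *)
pose t i := if a i.+1 is inl b then b else v.
pose fwd i := aug_arc (a i) (a i.+1).
have sz : exists i, (i.+1 < size s)%N && (a i.+1 \in aug_set G (dsc E v)).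
  exists (size p).-1; case: p @s us ls {ap au} @a {t fwd} => [|b p] // s us ls a.
  by rewrite /a /= leqnn (nth_last (inl v) (b :: p)) /= (ls : last b p = _) in_aug_set.
(* Any other vartheta_w on the trail would have [w] as neighbour on both sides, against the absence
   of repetitions, or would end the trail. *)
have inl_of i : (i.+1 < size s)%N -> a i.+1 = inl (t i).
  rewrite /t; case E1: (a i.+1) => [//|w'] hi; exfalso.
  have e1 : a i = inl (val w').
    have := ap i hi; rewrite -/(a i) -/(a i.+1) E1 /usym /=.
    by case: (a i) => [b|//] /= /eqP->.
  have [hi2|hi2] := ltnP i.+2 (size s).
    have e2 : a i.+2 = inl (val w').
      have := ap i.+1 hi2; rewrite -/(a i.+1) -/(a i.+2) E1 /usym /=.
      by case: (a i.+2) => [b|//]; rewrite /= orbF => /eqP->.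
    have := nth_uniq (inl v) (ltnW hi) hi2 us.
    by rewrite -/(a i) -/(a i.+2) e1 e2 eqxx; lia.
  have : a i.+1 = inl y.
    have -> : i.+1 = (size s).-1 by lia.
    by rewrite /a nth_last -ls.
  by rewrite E1.
case: (ex_minnP sz) => n1 /andP[n1s n1d] n1min.
have nd i : (i < n1)%N -> t i \notin dsc E v.
  move=> hi; have hi2 : (i.+1 < size s)%N by lia.
  apply/negP => ti; suff : (n1 <= i)%N by lia.
  by apply: n1min; rewrite hi2 inl_of // in_aug_set.
have t0 : t 0%N = val w.
  have h0 : (1 < size s)%N by lia.
  have := ap 0%N h0; rewrite -/(a 0%N) -/(a 1%N) (inl_of 0%N h0).
  by rewrite /usym /= orbF => /eqP->.
have n1_gt0 : (0 < n1)%N.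
  rewrite lt0n; apply/eqP => n10; move: n1d; rewrite n10.
  by rewrite inl_of ?in_aug_set ?t0 ?(negbTE nwv) //; lia.
pose n := n1.-1; have En : n1 = n.+1 by rewrite prednK.
have sn : (n.+2 < size s)%N by rewrite -En.
have aE i : (i <= n.+1)%N -> a i.+1 = inl (t i) by move=> hi; apply: inl_of; lia.
have fwdS i : (i <= n)%N -> fwd i.+1 = E (t i) (t i.+1).
  by move=> hi; rewrite /fwd !aE //; lia.
have edge i : (i <= n)%N -> if fwd i.+1 then E (t i) (t i.+1) else E (t i.+1) (t i).
  move=> hi; have hi2 : (i.+2 < size s)%N by lia.
  have := ap i.+1 hi2; rewrite -/(a i.+1) -/(a i.+2) fwdS // !aE; try lia.
  by rewrite /usym /=; case: ifP.
have act i : (i <= n)%N ->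
    if fwd i && ~~ fwd i.+1 then exists2 z, z \in fa G v & connect E (t i) z
    else t i \notin fa G v.
  move=> hi; have hi2 : (i.+2 < size s)%N by lia.
  have := au i hi2; rewrite -/(a i) -/(a i.+1) -/(a i.+2) => H.
  have {}H : unblocked (@aug_arc V G) (aug_set G (fa G v)) (a i) (inl (t i)) (inl (t i.+1)).
    by rewrite -!aE //; lia.
  move/aug_unblocked_inl: H; rewrite -aE -/(fwd i); last by lia.
  rewrite aE /=; last by lia.
  have -> : id_arc G (t i.+1) (t i) = ~~ fwd i.+1 => //.
  by have := edge i hi; rewrite fwdS //; case: ifP => // /(acyclic_asym acyc).
have nv i : (i <= n)%N -> t i != v.
  move=> hi; apply/eqP => tv; have := act i hi; case: ifP; last first.
    by rewrite tv !inE eqxx.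
  case/andP=> _ nf _; have := edge i hi; rewrite (negbTE nf) tv => tSv.
  have [hi'|hi'] := ltnP i n; last first.
    have Ei : i = n by lia.
    move: n1d; rewrite En inl_of ?in_aug_set //.
    rewrite inE => /andP[_]; rewrite -Ei.
    by apply/negP; exact: acyclic_connect.
  have := act i.+1 hi'; rewrite (negbTE nf) /=.
  by rewrite !inE (tSv : id_arc G (t i.+1) v) orbT.
have tn : t n.+1 \in dsc E v by move: n1d; rewrite En inl_of ?in_aug_set //; lia.
exists n, t, fwd; split=> //; split=> //.
- by rewrite t0; exact: valP.
- rewrite /fwd (aE 0%N) // t0 /a /=; exact: eqxx.
- apply: contraT => nf; have := edge n (leqnn n); rewrite (negbTE nf) => tE'.
  have : t n \in dsc E v by apply: (dsc_step acyc _ tE'); rewrite in_setU tn orbT.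
  by rewrite (negbTE (nd n _)) //; lia.
- by move=> i hi; rewrite in_setU1 negb_or nv // nd //; lia.
- move=> i j hi hj tij.
  have hi2 : (i.+1 < size s)%N by lia.
  have hj2 : (j.+1 < size s)%N by lia.
  have := nth_uniq (inl v) hi2 hj2 us; rewrite -/(a i.+1) -/(a j.+1) !aE; try lia.
  by rewrite tij eqxx => /esym/eqP[].
move=> i hi; have := act i hi; case: ifP => // _ [z zv tz].
exact: connect_trans tz (fa_connect zv).
Qed.

End NotSoluble.

Local Open Scope ring_scope.

(** * Configurations *)

Section Configurations.
Variables (V : finType) (X : V -> finType).
Implicit Types (z : cfgV X) (C D : {set V}).

(** This is equality of the projections on [C] ([agree_proj]); functions on X_C are thus handled as
    functions on X_V, away from dependent types. *)
Definition agree C z z' := [forall (v | v \in C), z v == z' v].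

Lemma agreeP C z z' : reflect {in C, forall v, z v = z' v} (agree C z z').
Proof.
apply: (iffP forallP) => [H v vC|H v]; last by apply/implyP => /H/eqP.
by have /implyP/(_ vC)/eqP := H v.
Qed.

Lemma agree_refl C z : agree C z z.
Proof. by apply/agreeP. Qed.

Lemma agree_sym C z z' : agree C z z' = agree C z' z.
Proof. by apply/agreeP/agreeP => H v /H ->. Qed.

Lemma agree_trans C z1 z2 z3 : agree C z1 z2 -> agree C z2 z3 -> agree C z1 z3.
Proof. by move=> /agreeP H /agreeP H'; apply/agreeP => v vC; rewrite H ?H'. Qed.

Lemma agreeS C D z z' : C \subset D -> agree D z z' -> agree C z z'.
Proof. by move=> /subsetP CD /agreeP H; apply/agreeP => v /CD/H. Qed.

Lemma agree_left C z1 z2 z : agree C z1 z2 -> agree C z z1 = agree C z z2.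
Proof.
move=> a12; apply/idP/idP => /agree_trans; apply => //.
by rewrite agree_sym.
Qed.

Lemma agree_proj C z z' : (proj C z == proj C z') = agree C z z'.
Proof.
apply/eqP/agreeP => [/ffunP H v vC|H].
  by have := H (exist _ v vC); rewrite !ffunE.
by apply/ffunP => -[v vC]; rewrite !ffunE /= H.
Qed.

Lemma agreeT z z' : agree [set: V] z z' = (z == z').
Proof.
apply/agreeP/eqP => [H|->//]; apply/ffunP => v.
by apply: H; rewrite inE.
Qed.

Definition upd z v (x : X v) : cfgV X := [ffun u => dfwith z x u].

Lemma upd_in z v x : upd z x v = x.
Proof. by rewrite ffunE dfwith_in. Qed.

Lemma upd_out z v (x : X v) u : v != u -> upd z x u = z u.
Proof. by move=> vu; rewrite ffunE dfwith_out. Qed.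

Lemma agree_upd C z v (x : X v) : v \notin C -> agree C (upd z x) z.
Proof.
by move=> vC; apply/agreeP => u uC; rewrite upd_out //; apply: contraNneq vC => ->.
Qed.

Lemma agree_set1U C z' z v (x : X v) : v \notin C ->
  agree (v |: C) z' (upd z x) = agree C z' z && (z' v == x).
Proof.
move=> vC; apply/agreeP/andP => [H|[/agreeP H /eqP zx] u].
  split; last by rewrite H ?setU11 // upd_in.
  apply: (agree_trans _ (agree_upd z x vC)).
  by apply/agreeP => u uC; rewrite H // inE uC orbT.
rewrite in_setU1 => /orP[/eqP->|uC]; first by rewrite upd_in.
by rewrite upd_out ?H //; apply: contraNneq vC => ->.
Qed.

Lemma upd_upd z v (x y : X v) : upd (upd z x) y = upd z y.
Proof.
apply/ffunP => u; have [<-|vu] := eqVneq v u; first by rewrite !upd_in.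
by rewrite !upd_out.
Qed.

Lemma upd_id z v : upd z (z v) = z.
Proof.
apply/ffunP => u; have [<-|vu] := eqVneq v u; first by rewrite !upd_in.
by rewrite !upd_out.
Qed.

Lemma agree_upd2 C z z' v (x : X v) :
  agree C z z' -> agree (v |: C) (upd z x) (upd z' x).
Proof.
move=> /agreeP H; apply/agreeP => u; rewrite in_setU1.
have [<- _|vu] := eqVneq v u; first by rewrite !upd_in.
by move=> /= /H; rewrite !upd_out.
Qed.

Hypothesis X_gt0 : forall v, (0 < #|X v|)%N.

Definition cfg0 : cfgV X := [ffun v => enum_val (Ordinal (X_gt0 v))].

Definition extend C (x : cfg X C) z : cfgV X :=
  [ffun v => if insub v is Some u then
     (if val u =P v is ReflectT uv then ecast j (X j) uv (x u) else z v)
   else z v].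

Lemma extend_in C (x : cfg X C) z u : extend x z (val u) = x u.
Proof.
rewrite ffunE valK; case: eqP => // uv.
by rewrite (_ : uv = erefl) // eq_axiomK.
Qed.

Lemma proj_extend C (x : cfg X C) z : proj C (extend x z) = x.
Proof. by apply/ffunP => u; rewrite ffunE extend_in. Qed.

Lemma proj_onto C (x : cfg X C) : exists z, x = proj C z.
Proof. by exists (extend x cfg0); rewrite proj_extend. Qed.

End Configurations.

(** * Marginals of a product of conditional distributions *)

Section Kernels.
Variables (R : realType) (V : finType) (E : rel V) (X : V -> finType).
Hypothesis acyc : acyclic E.
Hypothesis X_gt0 : forall v, (0 < #|X v|)%N.
Implicit Types (K : V -> cfgV X -> R) (z : cfgV X) (A C D : {set V}).

(** [K v z] is read as the probability of [z v] given the coordinates of [z] at the parents of [v];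
    chance vertices and decisions are treated alike. *)
Record kernels K : Prop := Kernels {
  kernel_ge0 : forall v z, 0 <= K v z;
  kernel_sum1 : forall v z, \sum_(x : X v) K v (upd z x) = 1;
  kernel_local : forall v z z', agree (Defs.family E v) z z' -> K v z = K v z'
}.

Definition ancestral A := forall u v, E u v -> v \in A -> u \in A.

Definition weight K A z := \prod_(v in A) K v z.

Definition marg K C z : R := \sum_(z' | agree C z' z) weight K [set: V] z'.

(** Induction on the complement of [A]: a vertex outside [A] with the fewest ancestors has all its
    parents in [A], and its kernel sums to 1. *)
Lemma marg_ancestral K A z : kernels K -> ancestral A -> marg K A z = weight K A z.
Proof.
move=> kK; rewrite /marg; have [n] := ubnP #|~: A|.
elim: n A z => // n IH A z /ltnSE cA aA.
have [->|AT] := eqVneq A [set: V].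
  by rewrite (big_pred1 z) // => z'; rewrite /= agreeT.
have [v0 v0A] : exists v0, v0 \in ~: A.
  by apply/set0Pn; apply: contra AT => /eqP A0; rewrite -(setCK A) A0 setC0.
case: (arg_minnP (fun v => #|[set u | connect E u v]|) v0A) => v vA vmin.
have pA u : E u v -> u \in A.
  move=> uv; apply: contraT => uA.
  have /vmin : u \in ~: A by rewrite inE.
  by rewrite leqNgt (acyclic_height acyc uv).
have {}vA : v \notin A by rewrite -in_setC.
have aA' : ancestral (v |: A).
  move=> u w uw; rewrite !in_setU1 => /orP[/eqP wv|wA]; last by rewrite (aA _ _ uw) ?orbT.
  by rewrite pA ?orbT // -wv.
have cA' : (#|~: (v |: A)| < n)%N.
  apply: leq_trans cA; apply: proper_card; apply/properP; split.
    by apply/subsetP => u; rewrite !inE negb_or => /andP[].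
  by exists v; rewrite !inE ?eqxx.
rewrite (partition_big (fun z' : cfgV X => z' v) predT) //=.
transitivity (\sum_(x : X v) weight K (v |: A) (upd z x)).
  apply: eq_bigr => x _; rewrite -IH //; apply: eq_bigl => z'.
  by rewrite agree_set1U.
under eq_bigr do rewrite /weight big_setU1 //=.
transitivity ((\sum_(x : X v) K v (upd z x)) * weight K A z); last by rewrite kernel_sum1 ?mul1r.
rewrite mulr_suml; apply: eq_bigr => x _.
congr (_ * _); rewrite /weight; apply: eq_bigr => u uA; apply: kernel_local => //.
apply: agree_upd; rewrite !inE negb_or; apply/andP; split.
  by apply: contraNneq vA => ->.
by apply: contra vA => /aA; apply.
Qed.

Lemma kernels_uniform : kernels (fun v _ => #|X v|%:R^-1).
Proof.
split=> [v z|v z|//]; first by rewrite invr_ge0 ler0n.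
by rewrite sumr_const -[RHS](@mulVf _ #|X v|%:R) ?pnatr_eq0 -?lt0n // mulr_natr.
Qed.

(** The product of the [#|X v|] over [v] outside [A], that is, the number of extensions of a
    configuration of [A]. As a quotient of uniform weights it comes directly from
    [marg_ancestral]. *)
Definition free_card A : R :=
  (\prod_(v in A) #|X v|%:R^-1) / \prod_(v in [set: V]) #|X v|%:R^-1.

Lemma prod_uniform_neq0 A : \prod_(v in A) (#|X v|%:R^-1 : R) != 0.
Proof. by apply/prodf_neq0 => v _; rewrite invr_neq0 ?pnatr_eq0 -?lt0n. Qed.

Lemma free_card_neq0 A : free_card A != 0.
Proof. by rewrite mulf_neq0 ?invr_neq0 ?prod_uniform_neq0. Qed.

Lemma sum_agree1 A z : ancestral A ->
  \sum_(z' : cfgV X | agree A z' z) 1 = free_card A.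
Proof.
move=> aA; apply: canRL (mulfK (prod_uniform_neq0 _)) _.
rewrite -[RHS](marg_ancestral z kernels_uniform aA) mulr_suml.
by apply: eq_bigr => z' _; rewrite mul1r.
Qed.

(** A marginal inside an ancestral set involves only the kernels of that set; in the sum on the
    right each configuration of [A] is counted once per extension. *)
Lemma marg_weight K A C z : kernels K -> ancestral A -> C \subset A ->
  marg K C z * free_card A = \sum_(z' | agree C z' z) weight K A z'.
Proof.
move=> kK aA CA; under [RHS]eq_bigr do rewrite -marg_ancestral // /marg.
rewrite (exchange_big_dep (fun z' => agree C z' z)) /=; last first.
  by move=> z1 z2 H /(agreeS CA) /agree_trans; apply.
rewrite mulr_suml; apply: eq_bigr => z' z'C.
rewrite -(sum_agree1 z' aA) mulr_sumr; apply: eq_big => [z''|? _]; last by rewrite mulr1.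
rewrite [agree A z' z'']agree_sym; apply/idP/andP => [H|[]//]; split=> //.
exact: agree_trans (agreeS CA H) z'C.
Qed.

Lemma marg_eq K K' A C z : kernels K -> kernels K' -> ancestral A -> C \subset A ->
  (forall v z', v \in A -> K v z' = K' v z') -> marg K C z = marg K' C z.
Proof.
move=> kK kK' aA CA KK'; apply: (mulIf (free_card_neq0 A)); rewrite !marg_weight //.
by apply: eq_bigr => z' _; apply: eq_bigr => v vA; rewrite KK'.
Qed.

Lemma marg_ge0 K C z : kernels K -> 0 <= marg K C z.
Proof.
by move=> kK; apply: sumr_ge0 => z' _; apply: prodr_ge0 => v _; apply: kernel_ge0.
Qed.

Lemma marg_agree K C z z' : agree C z z' -> marg K C z = marg K C z'.
Proof. by move=> zz'; apply: eq_bigl => z''; exact: agree_left. Qed.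

Lemma marg0 K z : kernels K -> marg K set0 z = 1.
Proof.
move=> kK; rewrite marg_ancestral // => [|u v _]; last by rewrite inE.
by rewrite /weight big_set0.
Qed.

Lemma weight_ge0 K A z : kernels K -> 0 <= weight K A z.
Proof. by move=> kK; apply: prodr_ge0 => v _; apply: kernel_ge0. Qed.

Lemma marg_gt0P K C z : kernels K ->
  reflect (exists2 z', agree C z' z & 0 < weight K [set: V] z') (0 < marg K C z).
Proof.
move=> kK; apply: (iffP idP) => [|[z' z'C z'0]].
  rewrite lt_neqAle eq_sym => /andP[+ _].
  rewrite psumr_neq0 => [/hasP[z' _ /andP[]]|z' _]; last exact: weight_ge0.
  by exists z'.
rewrite /marg (bigD1 z') //=; apply: ltr_wpDr => //.
by apply: sumr_ge0 => ? _; exact: weight_ge0.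
Qed.

Lemma marg_gt0S K C D z : kernels K -> C \subset D -> 0 < marg K D z -> 0 < marg K C z.
Proof.
move=> kK CD /(marg_gt0P _ _ kK)[z' /(agreeS CD) ? ?].
by apply/marg_gt0P => //; exists z'.
Qed.

Lemma marg_eq0 K C D z : kernels K -> C \subset D -> marg K C z = 0 -> marg K D z = 0.
Proof.
move=> kK CD C0; apply/eqP; apply: contraT => D0.
have : 0 < marg K D z by rewrite lt_neqAle eq_sym D0 marg_ge0.
by move=> /(marg_gt0S kK CD); rewrite C0 ltxx.
Qed.

Lemma weight_gt0 K A z : kernels K -> 0 < weight K A z ->
  {in A, forall v, 0 < K v z}.
Proof.
move=> kK + v vA; rewrite /weight (bigD1 v) //= !lt_neqAle (kernel_ge0 kK) andbT.
move=> /andP[+ _]; rewrite !(eq_sym 0).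
by apply: contraNneq => ->; rewrite mul0r.
Qed.

Lemma kernels_dirac K v z : kernels K ->
  kernels (fun w z' => if w == v then (z' v == z v)%:R else K w z').
Proof.
move=> kK; split=> [w z'|w z'|w z1 z2 ag].
- by case: ifP => _; [rewrite ler0n | apply: kernel_ge0].
- have [->|wv] := eqVneq w v; last by rewrite kernel_sum1.
  rewrite (bigD1 (z v)) //= upd_in eqxx big1 ?addr0 // => x.
  by rewrite upd_in => /negbTE->.
case: eqVneq ag => [-> /agreeP ag|_ ag]; last exact: kernel_local.
by rewrite ag // !inE eqxx.
Qed.

(* The marginal on [C :\ v] is unchanged when the distribution of [X_v] is
   replaced by the Dirac mass at [z v]. *)
Lemma marg_markov K A C v z : kernels K -> ancestral A -> v \notin A ->
  Defs.family E v \subset C -> C :\ v \subset A ->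
  marg K C z = marg K (C :\ v) z * K v z.
Proof.
move=> kK aA vA faC CA.
have vC : v \in C by apply: (subsetP faC); rewrite !inE eqxx.
pose K' w z' := if w == v then (z' v == z v)%:R else K w z'.
have kK' : kernels K' by exact: kernels_dirac.
rewrite (@marg_eq K K' A (C :\ v)) //; last first.
  by move=> w z' wA; rewrite /K'; case: eqVneq => // wv; rewrite wv (negbTE vA) in wA.
rewrite /marg mulr_suml.
rewrite [RHS](bigID (fun z' : cfgV X => z' v == z v)) /= [X in _ + X]big1 ?addr0; last first.
  move=> z' /andP[_ /negbTE nv]; rewrite /weight (bigD1 v) ?inE //=.
  by rewrite /K' eqxx nv !mul0r.
apply: eq_big => [z'|z' z'C].
  rewrite -agree_set1U; last by rewrite !inE eqxx.
  by rewrite upd_id setD1K.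
rewrite /weight (bigD1 v) ?inE //= [in RHS](bigD1 v) ?inE //=.
have zv : z' v = z v by move/agreeP: z'C => ->.
rewrite /K' zv !eqxx mul1r mulrC; congr (_ * _).
  by apply: eq_bigr => w /andP[_ /negbTE->].
by apply: kernel_local => //; exact: agreeS faC z'C.
Qed.

Lemma weight_gt0_extend K A z : kernels K -> ancestral A ->
  {in A, forall v, 0 < K v z} ->
  exists2 z', agree A z' z & 0 < weight K [set: V] z'.
Proof.
move=> kK aA K0; apply/(marg_gt0P _ _ kK); rewrite marg_ancestral //.
exact: prodr_gt0.
Qed.

End Kernels.

(** * Partial sums of moments *)

Section SumOut.
Variables (R : realType) (V : finType) (X : V -> finType).
Hypothesis X_gt0 : forall v, (0 < #|X v|)%N.
Variable C : {set V}.
Implicit Types (D : {set V}) (m : cfg X C -> R) (z : cfgV X).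

Lemma sum_out_condP D z' z :
  [forall u : {v | v \in C}, (val u \notin D) ==> (proj C z' u == z (val u))]
  = agree (C :\: D) z' z.
Proof.
apply/forallP/agreeP => [H u|H [u uC]].
  rewrite inE => /andP[uD uC].
  by have /implyP/(_ uD)/eqP := H (exist _ u uC); rewrite ffunE.
by apply/implyP => /= uD; rewrite ffunE /= H // inE uD.
Qed.

Lemma sum_out_agree D m z z' : agree (C :\: D) z z' ->
  sum_out D m z = sum_out D m z'.
Proof.
move=> zz'; apply: eq_bigl => x; have [z'' ->] := proj_onto X_gt0 x.
by rewrite !sum_out_condP; exact: agree_left.
Qed.

Lemma sum_out_ge0 D m z : (forall x, 0 <= m x) -> 0 <= sum_out D m z.
Proof. by move=> m0; apply: sumr_ge0. Qed.

Lemma le_sum_out D m z : (forall x, 0 <= m x) -> m (proj C z) <= sum_out D m z.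
Proof.
move=> m0; rewrite /sum_out (bigD1 (proj C z)) ?sum_out_condP ?agree_refl //=.
by rewrite lerDl sumr_ge0.
Qed.

Lemma eq_sum_out D m m' z :
  (forall z', agree (C :\: D) z' z -> m (proj C z') = m' (proj C z')) ->
  sum_out D m z = sum_out D m' z.
Proof.
move=> H; apply: eq_bigr => x; have [z' ->] := proj_onto X_gt0 x.
by rewrite sum_out_condP => /H.
Qed.

Lemma sum_out_sum D (F : cfgV X -> R) z :
  sum_out D (fun x => \sum_(z' | proj C z' == x) F z') z
  = \sum_(z' | agree (C :\: D) z' z) F z'.
Proof.
rewrite /sum_out (partition_big (proj C) (fun x => [forall u : {v | v \in C},
  (val u \notin D) ==> (x u == z (val u))])) /=; last first.
  by move=> z'; rewrite sum_out_condP.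
apply: eq_bigr => x Px; apply: eq_bigl => z'.
apply/idP/andP => [/eqP xz'|[]//]; split; last exact/eqP.
by rewrite -sum_out_condP xz'.
Qed.

Lemma sum_out1 v m z : v \in C ->
  sum_out [set v] m z = \sum_(x : X v) m (proj C (upd z x)).
Proof.
move=> vC; pose u0 : {v | v \in C} := exist _ v vC.
rewrite /sum_out (reindex (fun x : X v => proj C (upd z x))) /=; last first.
  exists (fun y : cfg X C => y u0) => [x _|y].
    by have := ffunE (fun u : {v | v \in C} => upd z x (val u)) u0; rewrite /= upd_in.
  have [z' ->] := proj_onto X_gt0 y; rewrite inE sum_out_condP => /agreeP H.
  apply/ffunP => -[u uC]; rewrite ![proj C _ _]ffunE /=.
  have [<-|vu] := eqVneq v u; first by rewrite upd_in.
  by rewrite upd_out // H // !inE eq_sym vu.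
apply: eq_bigl => x; rewrite sum_out_condP.
apply/agreeP => u; rewrite !inE => /andP[uv _].
by rewrite upd_out // eq_sym.
Qed.

End SumOut.

(** * Policies as systems of kernels *)

Section ConditionalFamilies.
Variables (R : realType) (V : finType) (G : influence_diagram V).
Variable X : V -> finType.
Hypothesis X_gt0 : forall v, (0 < #|X v|)%N.
Notation E := (id_arc G).

Lemma family_fa v : Defs.family E v = fa G v. Proof. by []. Qed.

Lemma pa_irr v : v \notin pa G v.
Proof. by rewrite inE (acyclic_irr (@arc_acyclic _ G)). Qed.

(* The coordinates off the parents of [v] are those of [cfg0], so that [cond_of f]
   represents [f] only if [f v] is a function of the family of [v]. *)
Definition cond_of (f : V -> cfgV X -> R) : cond_family R G X :=
  fun v y x => f v (upd (extend y (cfg0 X_gt0)) x).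

Lemma cond_ofE f v z :
  (forall z', agree (fa G v) z' z -> f v z' = f v z) ->
  cond_of f (proj (pa G v) z) (z v) = f v z.
Proof.
move=> fl; apply: fl; apply/agreeP => u; rewrite !inE.
have [->|uv /= ue] := eqVneq u v; first by rewrite upd_in.
rewrite upd_out 1?eq_sym //.
have up : u \in pa G v by rewrite inE.
by rewrite (extend_in _ _ (exist _ u up)) ffunE.
Qed.

Lemma cond_of_distribution f v y :
  (forall z, 0 <= f v z) -> (forall z, \sum_(x : X v) f v (upd z x) = 1) ->
  is_distribution (@cond_of f v y).
Proof. by move=> f0 f1; split=> [x|]; [exact: f0 | exact: f1]. Qed.

End ConditionalFamilies.

Section Policies.
Variables (R : realType) (V : finType) (G : influence_diagram V).
Variable rho : parametrization R G.
Notation X := (states rho).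
Notation E := (id_arc G).
Let X_gt0 := @states_nonempty R V G rho.
Implicit Types (d : cond_family R G X) (z : cfgV X).

Definition kernel_of d v z : R :=
  if v \in Va G then d v (proj (pa G v) z) (z v)
  else chance_kernel (proj (pa G v) z) (z v).



Lemma kernels_of d : is_policy d -> kernels E (kernel_of d).
Proof.
move=> dP; split=> [v z|v z|v z z' ag].
- rewrite /kernel_of; case: ifP => vA; first by case: (dP v vA (proj (pa G v) z)).
  by case: (@kernel_distribution _ _ _ rho v _ (proj (pa G v) z)); rewrite ?inE ?vA.
- have pE (x : X v) : proj (pa G v) (upd z x) = proj (pa G v) z.
    by apply/eqP; rewrite agree_proj; apply: agree_upd; exact: pa_irr.
  have [vA|vA] := boolP (v \in Va G).
    under eq_bigr do rewrite /kernel_of vA pE upd_in.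
    by case: (dP v vA (proj (pa G v) z)).
  under eq_bigr do rewrite /kernel_of (negbTE vA) pE upd_in.
  by case: (@kernel_distribution _ _ _ rho v _ (proj (pa G v) z)); rewrite ?inE.
rewrite /kernel_of; have -> : proj (pa G v) z = proj (pa G v) z'.
  by apply/eqP; rewrite agree_proj; apply: agreeS ag; apply: subsetUr.
have -> // : z v = z' v by move/agreeP: ag => ->; rewrite ?setU11.
Qed.

Lemma prob_weight d z : prob d z = weight (kernel_of d) [set: V] z.
Proof.
rewrite /prob /weight [RHS](bigID (fun v => v \in Va G)) /= mulrC.
congr (_ * _); apply: eq_big => v; rewrite ?inE //.
  by rewrite /kernel_of => ->.
by rewrite /kernel_of => /negbTE->.
Qed.

Lemma marginal_marg d C z : marginal d (proj C z) = marg (kernel_of d) C z.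
Proof.
rewrite /marginal /marg; apply: eq_big => [z'|z' _]; last exact: prob_weight.
by rewrite agree_proj.
Qed.

Lemma sum_out_marginal d C D z :
  sum_out D (marginal d (C := C)) z = marg (kernel_of d) (C :\: D) z.
Proof.
rewrite (@sum_out_sum R V X C D (prob d) z).
by apply: eq_bigr => z' _; exact: prob_weight.
Qed.

End Policies.

(** * Two coordinated policies whose average is not achievable *)

Section Midpoint.
Variables (R : realType) (V : finType) (G : influence_diagram V).
Variable rho : parametrization R G.

Lemma achievable_midpoint (N : {set {set V}}) (d1 d2 : cond_family R G (states rho)) :
  convex_set (achievable rho N) -> is_policy d1 -> is_policy d2 ->
  exists2 d : cond_family R G (states rho), is_policy d &
    forall C, C \in N -> forall z,
      marg (kernel_of d) C z =
      (marg (kernel_of d1) C z + marg (kernel_of d2) C z) / 2.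
Proof.
move=> cvx d1P d2P.
pose mom_of (d : cond_family R G (states rho)) : {ffun moment_index rho N -> R^o} :=
  [ffun i : moment_index rho N => marginal d (tagged i) : R^o].
have mom_ofP d : is_policy d -> (mom_of d : moment_space rho N) \in achievable rho N.
  by move=> dP; apply: mem_set; exists d => // i; rewrite ffunE.
have half0 : 0 <= (2^-1 : R) by lra.
have half1 : (2^-1 : R) <= 1 by lra.
have := cvx _ _ (Itv01 half0 half1) (mom_ofP _ d1P) (mom_ofP _ d2P).
move=> /set_mem[d dP dE]; exists d => // C CN z.
have := dE (Tagged (fun C : {C : {set V} | C \in N} => cfg (states rho) (val C))
   (proj C z : cfg (states rho) (val (exist _ C CN)))).
rewrite /conv /= !ffunE /= !marginal_marg => <-.
by rewrite /GRing.scale /= /unstable.onem; lra.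
Qed.

End Midpoint.

Section Coordination.
Variables (R : realType) (V : finType) (G : influence_diagram V).
Notation E := (id_arc G).
Let acyc : acyclic E := @arc_acyclic V G.
Variables (v : V) (n : nat) (t : nat -> V) (fwd : nat -> bool).
Hypothesis vA : v \in Va G.
Hypothesis trail : relevant_trail G v n t fwd.

(* Every vertex has one bit for each channel [c : V]. The bits drawn or copied along
   the trail, as well as the guess of [v], are on channel [v]. If [c] is a collider,
   then channel [c] carries the sum of the bits of the two edges at [c] to all the
   descendants of [c], hence to [v]. The bit of [vartheta_(t 0)] is [k], and [v]
   recovers the bit of [t n] from [k] and the sums. All the other bits are free. *)
Let T : finType := {ffun V -> bool}.
Let X : V -> finType := fun _ => T.
Implicit Types (z : cfgV X) (k : bool) (w c : V).

Let X_gt0 w : (0 < #|X w|)%N.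
Proof. by apply/card_gt0P; exists [ffun => false]. Qed.

Definition channel z w c : bool := (z w : {ffun V -> bool}) c.

Definition collider i := fwd i && ~~ fwd i.+1.

(** The bit of an edge is stored at its tail; edge 0 has tail vartheta_(t 0), whose bit is [k]. *)
Definition edge_bit k z i : bool :=
  if i is j.+1 then if fwd i then channel z (t j) v else channel z (t i) v else k.

Arguments edge_bit : simpl never.

Let edge_bitS k z i : edge_bit k z i.+1 =
  if fwd i.+1 then channel z (t i) v else channel z (t i.+1) v.
Proof. by []. Qed.

(** The parent from which [w] copies channel [c]; there is one exactly when [w] descends from [c],
    and the default [w] stands for its absence. *)
Definition relay c w : V := odflt w [pick p | E p w && connect E c p].

Definition copies w z := [forall c, (w \in dsc E c) ==>
  (channel z w c == channel z (relay c w) c)].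

(** One equation for all shapes: at a chain or a fork the two edge bits agree (trivially at a fork,
    the tail of both), and at a collider their sum is its own channel. *)
Definition follows_trail k w z := [forall i : 'I_n.+1, (t i == w) ==>
  (edge_bit k z i (+) edge_bit k z i.+1 == collider i && channel z w w)].

Definition decode z := \big[addb/false]_(i < n.+1 | collider i) channel z v (t i).

Definition consistent k w z := [&& copies w z, follows_trail k w z &
  (w == v) ==> (channel z v v == k (+) decode z)].

Let relayP c w : w \in dsc E c -> E (relay c w) w && connect E c (relay c w).
Proof.
rewrite inE => /andP[nwc /connectP[p]]; case/lastP: p => [|p y] /=.
  by move=> _ wc; rewrite wc eqxx in nwc.
rewrite rcons_path last_rcons => /andP[cp ly] wy; subst y.
rewrite /relay; case: pickP => //= /(_ (last c p)).
by rewrite ly; have -> : connect E c (last c p) by apply/connectP; exists p.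
Qed.

Let channel_agree w z z' x c : agree (fa G w) z z' -> x \in fa G w ->
  channel z x c = channel z' x c.
Proof. by move=> /agreeP H /H; rewrite /channel => ->. Qed.

Let in_fa_self w : w \in fa G w. Proof. by rewrite !inE eqxx. Qed.

Let in_fa_parent x w : E x w -> x \in fa G w.
Proof. by move=> xw; rewrite !inE (xw : id_arc G x w) orbT. Qed.

Let tn_neq i : (i <= n)%N -> t i != v.
Proof. by move=> /(trail_inner trail); rewrite in_setU1 negb_or => /andP[]. Qed.

Let t_nd i : (i <= n)%N -> t i \notin dsc E v.
Proof. by move=> /(trail_inner trail); rewrite in_setU1 negb_or => /andP[]. Qed.

Let fwd_edge i : (i <= n)%N -> fwd i.+1 -> E (t i) (t i.+1).
Proof. by move=> /(trail_edge trail) + f; rewrite f. Qed.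

Let bwd_edge i : (i <= n)%N -> ~~ fwd i.+1 -> E (t i.+1) (t i).
Proof. by move=> /(trail_edge trail) + /negbTE f; rewrite f. Qed.

Let edge_bit_agree k i z z' : (i <= n)%N -> agree (fa G (t i)) z z' ->
  edge_bit k z i = edge_bit k z' i /\ edge_bit k z i.+1 = edge_bit k z' i.+1.
Proof.
move=> hi ag; split.
  case: i hi ag => [//|i] hi ag; rewrite !edge_bitS; case: ifP => f; apply: channel_agree ag _ => //.
  by apply: in_fa_parent; apply: fwd_edge => //; lia.
rewrite !edge_bitS; case: ifPn => f; apply: channel_agree ag _ => //.
by apply: in_fa_parent; apply: bwd_edge.
Qed.

Lemma consistent_agree k w z z' : agree (fa G w) z z' ->
  consistent k w z = consistent k w z'.
Proof.
move=> ag; congr [&& _, _ & _].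
- apply: eq_forallb => c; case: (boolP (w \in dsc E c)) => //= wc.
  have /andP[rw _] := relayP wc.
  by rewrite (channel_agree c ag (in_fa_self w)) (channel_agree c ag (in_fa_parent rw)).
- apply: eq_forallb => i; case: eqVneq => [tw|//]; rewrite -tw in ag *.
  have [-> ->] := edge_bit_agree k (ltn_ord i : (i <= n)%N) ag.
  by rewrite (channel_agree _ ag (in_fa_self _)).
case: eqVneq => //= wv; rewrite wv in ag.
rewrite (channel_agree _ ag (in_fa_self _)); congr (_ == _ (+) _).
by apply: eq_bigr => i _; rewrite (channel_agree _ ag (in_fa_self _)).
Qed.

(** The bit [k] is used only at [t 0] and [v], which are decisions; hence one parametrization serves
    both policies. *)
Lemma consistent_bit k k' w z : w != t 0%N -> w != v ->
  consistent k w z = consistent k' w z.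
Proof.
move=> wt /negbTE wv; rewrite /consistent wv; congr [&& _, _ & _].
apply: eq_forallb => -[[|i] hi] //=.
by case: eqVneq => // tw; rewrite -tw eqxx in wt.
Qed.

Let trail_value k w z (i : nat) : T := [ffun c =>
  if collider i then (c == w) && (edge_bit k z i (+) edge_bit k z i.+1)
  else (c == v) && (if fwd i then edge_bit k z i else edge_bit k z i.+1)].

Let value k w z : T := [ffun c => if w \in dsc E c then channel z (relay c w) c
  else if w == v then (c == v) && (k (+)
     \big[addb/false]_(i < n.+1 | collider i) channel z (relay (t i) v) (t i))
  else if [pick i : 'I_n.+1 | t i == w] is Some i then trail_value k w z i c
  else false].

(** The requirements on [w] concern distinct channels: copies use channels of which [w] is a strict
    descendant, whereas the trail and the guess use channel [v] outside [dsc E v], or the own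
    channel of a collider. So they can always be met, and [uniform_kernel] is a distribution. *)
Lemma consistent_value k w z : consistent k w (upd z (value k w z : X w)).
Proof.
set z' := upd _ _.
have z'w c : channel z' w c = value k w z c by rewrite /channel /z' upd_in.
have z'n x c : x != w -> channel z' x c = channel z x c.
  by move=> xw; rewrite /channel /z' upd_out // eq_sym.
have neq x : E x w -> x != w by move=> xw; apply: contraTneq xw => ->; rewrite acyclic_irr.
have nd c : c \notin dsc E c by rewrite inE eqxx.
apply/and3P; split.
- apply/forallP => c; apply/implyP => wc.
  have /andP[rw _] := relayP wc.
  by rewrite z'w ffunE wc z'n // neq.
- apply/forallP => i; apply/implyP => /eqP tw.
  have hi : (i <= n)%N := ltn_ord i.
  have wv : (w == v) = false by rewrite -tw; apply/negbTE/tn_neq.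
  have wnd : (w \in dsc E v) = false by rewrite -tw; apply/negbTE/t_nd.
  have pickE : [pick i : 'I_n.+1 | t i == w] = Some i.
    case: pickP => [j /eqP tj|/(_ i)]; last by rewrite tw eqxx.
    congr Some; apply/ord_inj/(trail_inj trail) => //; first exact: ltn_ord j.
    by rewrite tj tw.
  have valE c : w \notin dsc E c -> channel z' w c = trail_value k w z i c.
    by move=> /negbTE wc; rewrite z'w ffunE wc wv pickE.
  have in_bit : fwd i -> edge_bit k z' i = edge_bit k z i.
    case: (i : nat) tw hi => [//|j] tw hi f; rewrite !edge_bitS f z'n // neq // -tw.
    by apply: fwd_edge f; lia.
  have out_bit : ~~ fwd i.+1 -> edge_bit k z' i.+1 = edge_bit k z i.+1.
    by move=> f; rewrite !edge_bitS (negbTE f) z'n // neq // -tw; exact: bwd_edge.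
  have in_bit' : ~~ fwd i -> edge_bit k z' i = channel z' w v.
    by case: (i : nat) tw => [|j] tw f; [rewrite (trail_fwd0 trail) in f | rewrite edge_bitS (negbTE f) tw].
  have out_bit' : fwd i.+1 -> edge_bit k z' i.+1 = channel z' w v.
    by move=> f; rewrite edge_bitS f tw.
  have vE := valE v (negbT wnd); rewrite ffunE eqxx /= in vE.
  have [ci|ci] := boolP (collider i).
    have /andP[f1 f2] := ci.
    by rewrite in_bit // out_bit // valE ?nd // ffunE ci eqxx.
  rewrite /collider in ci; rewrite /collider (negbTE ci) /= in vE *.
  have [f1|f1] := boolP (fwd i).
    have f2 : fwd i.+1 by move: ci; rewrite f1 negbK.
    by rewrite in_bit // out_bit' // vE f1 addbb.
  rewrite in_bit' // vE (negbTE f1); have [f2|f2] := boolP (fwd i.+1).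
    by rewrite out_bit' // vE (negbTE f1) addbb.
  by rewrite out_bit // addbb.
apply/implyP => /eqP wv; rewrite -{1 2}wv z'w ffunE wv (negbTE (nd v)) !eqxx /=.
apply/eqP; congr (_ (+) _); apply: eq_bigr => i ci.
have hi : (i <= n)%N := ltn_ord i.
have vd : v \in dsc E (t i).
  rewrite inE eq_sym tn_neq //=.
  by have := trail_active trail hi; rewrite -/(collider i) ci.
by rewrite -{2}wv z'w ffunE wv vd.
Qed.

Let choices k w z : nat := #|[set x : X w | consistent k w (upd z x)]|.

Definition uniform_kernel k w z : R :=
  if consistent k w z then (choices k w z)%:R^-1 else 0.

Let choices_gt0 k w z : (0 < choices k w z)%N.
Proof. by apply/card_gt0P; exists (value k w z); rewrite inE consistent_value. Qed.

Let uniform_ge0 k w z : 0 <= uniform_kernel k w z.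
Proof. by rewrite /uniform_kernel; case: ifP => //; rewrite invr_ge0 ler0n. Qed.

Lemma uniform_gt0 k w z : (0 < uniform_kernel k w z) = consistent k w z.
Proof.
by rewrite /uniform_kernel; case: ifP => _; rewrite ?ltxx // invr_gt0 ltr0n choices_gt0.
Qed.

Let choices_upd k w z (x : X w) : choices k w (upd z x) = choices k w z.
Proof. by apply: eq_card => y; rewrite !inE upd_upd. Qed.

Let uniform_sum1 k w z : \sum_(x : X w) uniform_kernel k w (upd z x) = 1.
Proof.
rewrite /uniform_kernel -big_mkcond /=.
under eq_bigr => x _ do rewrite choices_upd.
rewrite sumr_const (_ : #|_| = choices k w z); last by apply: eq_card => x; rewrite inE.
by rewrite -[LHS]mulr_natr mulVf // pnatr_eq0 -lt0n choices_gt0.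
Qed.

Let uniform_agree k w z z' : agree (fa G w) z z' ->
  uniform_kernel k w z = uniform_kernel k w z'.
Proof.
move=> ag; rewrite /uniform_kernel (consistent_agree k ag); case: ifP => // _.
congr (_%:R^-1); apply: eq_card => x; rewrite !inE; apply: consistent_agree.
by apply: agreeS (agree_upd2 x ag); apply: subsetU; rewrite subxx orbT.
Qed.

Definition coordination_policy k : cond_family R G X := cond_of X_gt0 (uniform_kernel k).

Let coordination_distribution k w y : is_distribution (coordination_policy k (v := w) y).
Proof. by apply: cond_of_distribution. Qed.

Definition coordination_rho : parametrization R G :=
  Parametrization X_gt0 (chance_kernel := coordination_policy false)
    (fun w _ y => coordination_distribution false y) (fun _ _ => 0).
Notation rho := coordination_rho.

Let policyP k : is_policy (rho := rho) (coordination_policy k).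
Proof. by move=> w _ y; exact: coordination_distribution. Qed.

Let kernel_ofE k w z :
  kernel_of (rho := rho) (coordination_policy k) w z = uniform_kernel k w z.
Proof.
have condE k' : coordination_policy k' (proj (pa G w) z) (z w) = uniform_kernel k' w z.
  by apply: (@cond_ofE R V G X X_gt0 (uniform_kernel k')) => z'; exact: uniform_agree.
rewrite /kernel_of /= !condE; case: ifP => // wA.
have wt : w != t 0%N by apply: contraFneq wA => ->; exact: trail_start trail.
have wv : w != v by apply: contraFneq wA => ->.
have cE z' : consistent false w z' = consistent k w z' by exact: consistent_bit.
rewrite /uniform_kernel cE; case: ifP => // _; congr (_%:R^-1).
by apply: eq_card => x; rewrite !inE cE.
Qed.

Lemma coordination_weight_gt0 k z :
  0 < weight (kernel_of (rho := rho) (coordination_policy k)) [set: V] z <->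
  forall w, consistent k w z.
Proof.
have kK := kernels_of (policyP k).
split=> [/(weight_gt0 kK) H w|H].
  by rewrite -uniform_gt0 -kernel_ofE; apply: H; rewrite inE.
by apply: prodr_gt0 => w _; rewrite kernel_ofE uniform_gt0.
Qed.

Lemma copies_dsc z c w : (forall w, w \in dsc E c -> copies w z) ->
  connect E c w -> channel z w c = channel z c c.
Proof.
move=> cp; pose h x := #|[set y | connect E y x]|.
have [m] := ubnP (h w); elim: m w => // m IH w /ltnSE hw cw.
have [->//|nwc] := eqVneq w c.
have wd : w \in dsc E c by rewrite inE nwc.
have /forallP/(_ c)/implyP/(_ wd)/eqP -> := cp w wd.
have /andP[rw cr] := relayP wd.
apply: IH => //; apply: leq_trans hw; exact: acyclic_height.
Qed.

Let sum_edges k z m : \big[addb/false]_(i < m) (edge_bit k z i (+) edge_bit k z i.+1)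
  = k (+) edge_bit k z m.
Proof.
elim: m => [|m IH]; first by rewrite big_ord0 addbb.
by rewrite big_ord_recr /= IH -addbA [edge_bit k z m (+) _]addbA addbb addFb.
Qed.

(** Non-colliders contribute nothing to the sum over the trail of consecutive edge bits, so [decode]
    is this telescoping sum; adding [k] leaves the bit of the last edge, stored at [t n]. *)
Lemma consistent_guess k z : (forall w, consistent k w z) ->
  channel z v v = channel z (t n) v.
Proof.
move=> cz; have cp c w : w \in dsc E c -> copies w z by case/and3P: (cz w).
have /and3P[_ _] := cz v; rewrite eqxx /= => /eqP->.
have -> : decode z = \big[addb/false]_(i < n.+1) (edge_bit k z i (+) edge_bit k z i.+1).
  rewrite /decode big_mkcond; apply: eq_bigr => i _.
  have hi : (i <= n)%N := ltn_ord i.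
  have /and3P[_ /forallP/(_ i) + _] := cz (t i); rewrite eqxx /= => /eqP->.
  have := trail_active trail hi; rewrite -/(collider i); case: ifP => //= _ tv.
  by apply: copies_dsc tv; exact: cp.
by rewrite sum_edges addbA addbb addFb edge_bitS (trail_fwdn trail).
Qed.

Let flip (F : {set V}) z : cfgV X := [ffun w =>
  [ffun c => channel z w c (+) ((c == v) && (w \in F))] : X w].

Let flipE F z w c : channel (flip F z) w c = channel z w c (+) ((c == v) && (w \in F)).
Proof. by rewrite /channel /flip !ffunE. Qed.

(** The trail vertices that can be tails of trail edges; none of them is observed by [v]
    ([hidden_nfa]). *)
Let hidden : {set V} := [set w | [exists i : 'I_n.+1, (t i == w) && ~~ collider i]].

Let hiddenP i : (i <= n)%N -> (t i \in hidden) = ~~ collider i.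
Proof.
move=> hi; rewrite inE; apply/existsP/idP => [[j /andP[/eqP tj cj]]|ci].
  by rewrite -(trail_inj trail (ltn_ord j : (j <= n)%N) hi tj).
by exists (Ordinal (hi : (i < n.+1)%N)); rewrite /= eqxx.
Qed.

Let hidden_nd w : w \in hidden -> w \notin v |: dsc E v.
Proof.
by rewrite inE => /existsP[i /andP[/eqP <- _]]; apply: trail_inner trail _ _; exact: ltn_ord i.
Qed.

Let hidden_nfa w : w \in hidden -> w \notin fa G v.
Proof.
rewrite inE => /existsP[i /andP[/eqP <- ci]].
by have := trail_active trail (ltn_ord i : (i <= n)%N); rewrite -/(collider i) (negbTE ci).
Qed.

(* The bits that [v] does not observe are flipped together with its guess. *)
Lemma consistent_flip k z : (forall w, consistent k w z) ->
  forall w, consistent (~~ k) w (flip (hidden :|: (v |: dsc E v)) z).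
Proof.
set F := _ :|: _; set z' := flip _ _ => cz w.
have /and3P[cp ft gs] := cz w.
have other x c : c != v -> channel z' x c = channel z x c.
  by move=> /negbTE cv; rewrite flipE cv addbF.
have bits i : (i <= n.+1)%N -> edge_bit (~~ k) z' i = ~~ edge_bit k z i.
  case: i => [//|i] hi; rewrite !edge_bitS; case: ifP => f; rewrite flipE eqxx /= addbC.
    suff -> : t i \in F by [].
    by rewrite inE hiddenP ?(ltnSE hi) // /collider f andbF.
  suff -> : t i.+1 \in F by [].
  have hi' : (i.+1 <= n)%N.
    rewrite ltn_neqAle -ltnS hi andbT; apply: contraFneq f => ->; exact: trail_fwdn trail.
  by rewrite inE hiddenP // /collider f.
apply/and3P; split.
- apply/forallP => c; apply/implyP => wc.
  have /forallP/(_ c)/implyP/(_ wc)/eqP e := cp.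
  have [cv|cv] := eqVneq c v; last by rewrite !other // e.
  subst c; have /andP[rw cr] := relayP wc; rewrite !flipE e eqxx /=.
  have wF : w \in F by rewrite !in_setU wc !orbT.
  have rF : relay v w \in F.
    by apply/setUP; right; rewrite !inE cr andbT orbN.
  by rewrite wF rF.
- apply/forallP => i; apply/implyP => tw.
  have /forallP/(_ i)/implyP/(_ tw)/eqP e := ft.
  have hi : (i <= n)%N := ltn_ord i.
  rewrite !bits ?(leqW hi) // addNb addbN negbK e other // -(eqP tw).
  exact: tn_neq.
apply/implyP => wv; have /implyP/(_ wv)/eqP e := gs.
rewrite flipE eqxx e /= !in_setU in_set1 eqxx orbT.
have -> : decode z' = decode z.
  by apply: eq_bigr => i _; rewrite other // tn_neq //; exact: ltn_ord i.
by rewrite addbT addNb.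
Qed.

Lemma coordination_not_convex (N : {set {set V}}) (e : rel {set V}) :
  junction_tree G N e -> ~ convex_set (achievable rho N).
Proof.
case=> _ _ famN _ cvx.
have [d dP mE] := achievable_midpoint cvx (policyP false) (policyP true).
have kK := kernels_of dP; set K := kernel_of d in kK mE.
have kP k := kernels_of (policyP k).
have [C CN faC] : exists2 C : V -> {set V}, forall w, C w \in N & forall w, fa G w \subset C w.
  have H w : exists C : {set V}, C \in N /\ fa G w \subset C.
    by have [C CN fC] := famN w (in_setT w); exists C.
  by exists (fun w => projT1 (cid (H w))) => w; case: (cid (H w)) => C [].
(* The average charges what either policy charges. So on each family a configuration of positive
   probability looks consistent, for a value of [k] that may vary with the family. *)
have support z w : 0 < weight K [set: V] z ->
    exists k z', (forall x, consistent k x z') /\ agree (fa G w) z' z.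
  move=> z0; have : 0 < marg K (C w) z by apply/(marg_gt0P _ _ kK); exists z; rewrite ?agree_refl.
  rewrite mE // pmulr_lgt0 ?invr_gt0 // => m0.
  have [k /(marg_gt0P _ _ (kP k))[z' z'z /coordination_weight_gt0 z'0]] : exists k,
      0 < marg (kernel_of (rho := rho) (coordination_policy k)) (C w) z.
    have := marg_ge0 (C w) z (kP false); have := marg_ge0 (C w) z (kP true).
    case: (ltrP 0 (marg (kernel_of (rho := rho) (coordination_policy false)) (C w) z)).
      by exists false.
    by move=> ? ? ?; exists true; lra.
  by exists k, z'; split=> //; exact: agreeS (faC w) z'z.
have supported k z w : (forall x, consistent k x z) -> 0 < K w z.
  move=> /coordination_weight_gt0 z0.
  have mk : 0 < marg (kernel_of (rho := rho) (coordination_policy k)) (C w) z.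
    by apply/(marg_gt0P _ _ (kP k)); exists z; rewrite ?agree_refl.
  have : 0 < marg K (C w) z.
    rewrite mE // divr_gt0 //.
    have := marg_ge0 (C w) z (kP false); have := marg_ge0 (C w) z (kP true).
    by case: k {z0} mk => mk ? ?; lra.
  case/(marg_gt0P _ _ kK) => z' z'z /(weight_gt0 kK)/(_ w (in_setT _)).
  by rewrite (kernel_local kK (agreeS (faC w) z'z)).
(* The family of [t n.+1] contains both [t n] and the vertex relaying the guess of [v], so it
   suffices to compare the two bits there. *)
have guess z : 0 < weight K [set: V] z -> channel z v v = channel z (t n) v.
  move=> z0; have cp w : w \in dsc E v -> copies w z.
    move=> wv; have [k [z' [z'c z'z]]] := support z w z0.
    have /and3P[/forallP cp _ _] := z'c w; apply/forallP => c; apply/implyP => wc.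
    have /andP[rw _] := relayP wc.
    by have := cp c; rewrite wc /= !(channel_agree c z'z) // in_fa_parent.
  have yv := trail_last trail; have /andP[ry vr] := relayP yv.
  have [k [z' [z'c z'z]]] := support z (t n.+1) z0.
  have tny : E (t n) (t n.+1) by apply: fwd_edge => //; exact: trail_fwdn trail.
  rewrite -(copies_dsc cp vr) -!(channel_agree v z'z) ?in_fa_parent //.
  rewrite -(consistent_guess z'c); apply: copies_dsc vr => w _.
  by case/and3P: (z'c w).
have [z _ z0] : exists2 z, agree set0 z (cfg0 X_gt0) & 0 < weight K [set: V] z.
  by apply/(marg_gt0P _ _ kK); rewrite (marg0 acyc _ kK).
(* The hidden bits are flipped without the guess. On non-descendants of [v] all kernels stay
   positive: that of [v] sees no change, and the others see what [consistent_flip] produces. The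
   extension to the descendants of [v] then violates [guess]. *)
pose A : {set V} := ~: dsc E v.
have aA : ancestral E A.
  move=> x y xy; rewrite !in_setC; apply: contra => xv.
  by apply: (dsc_step acyc _ xy); rewrite in_setU xv orbT.
have [|z2 z2z z20] := @weight_gt0_extend _ _ _ _ acyc K A (flip hidden z) kK aA.
  move=> w; rewrite in_setC => wA; have [wv|wv] := eqVneq w v.
    have -> : K w (flip hidden z) = K w z.
      apply: (kernel_local kK); apply/agreeP => x; rewrite wv => xv.
      apply/ffunP => c; rewrite -[LHS]/(channel _ x c) flipE.
      by rewrite (contraTF (@hidden_nfa x) xv) andbF addbF.
    by apply: (weight_gt0 kK z0); rewrite inE.
  have [k [z1 [z1c z1z]]] := support z w z0.
  have := supported _ _ w (consistent_flip z1c).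
  set z1' := flip _ z1 => pos.
  have -> // : K w (flip hidden z) = K w z1'.
  apply: (kernel_local kK); apply/agreeP => x xw.
  apply/ffunP => c; rewrite -[LHS]/(channel _ x c) -[RHS]/(channel _ x c) !flipE.
  rewrite (channel_agree c z1z xw) in_setU.
  suff /negbTE-> : x \notin v |: dsc E v by rewrite orbF.
  case/setU1P: xw => [->|]; first by rewrite in_setU1 negb_or wv.
  by rewrite inE => xw; apply: contra wA => /dsc_step; apply.
have := guess _ z20; have := guess _ z0.
have inA x : x \in A -> channel z2 x v = channel (flip hidden z) x v.
  by move=> xA; rewrite /channel; move/agreeP: z2z => ->.
rewrite !inA ?flipE; last 2 first.
- by rewrite in_setC t_nd.
- by rewrite in_setC inE eqxx.
have /negbTE-> : v \notin hidden.
  by apply/negP => /hidden_nd; rewrite in_setU1 eqxx.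
rewrite hiddenP // /collider (trail_fwdn trail) eqxx /= andbF addbF addbT => ->.
by case: (channel z (t n) v).
Qed.

End Coordination.

Lemma not_soluble_not_convex (R : realType) (V : finType) (G : influence_diagram V) :
  ~ soluble G -> exists rho : parametrization R G,
    forall (N : {set {set V}}) (e : rel {set V}),
      junction_tree G N e -> ~ convex_set (achievable rho N).
Proof.
case/not_soluble_arc => v [u [vu uv]].
have [n [t [fwd [_ tr]]]] := relevance_trail vu uv.
have vA : v \in Va G by case/andP: vu.
by exists (coordination_rho R vA tr) => N e; exact: coordination_not_convex.
Qed.

(** * Policy independence *)

(** The inverses of the first [size p] positive integers are already too many roots. *)
Lemma poly_unit_interval_eq0 (R : realType) (p : {poly R}) :
  (forall t, 0 < t <= 1 -> p.[t] = 0) -> p = 0.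
Proof.
move=> p0; apply/eqP; apply: contraT => pn0.
pose rs : seq R := [seq i.+1%:R^-1 | i <- iota 0 (size p)].
have : (size rs < size p)%N.
  apply: max_poly_roots => //.
    apply/allP => _ /mapP[i _ ->]; rewrite rootE p0 // invr_gt0 ltr0n /=.
    by rewrite invf_le1 ?ltr0n // ler1n.
  rewrite map_inj_uniq ?iota_uniq // => i j /invr_inj /eqP.
  by rewrite eqr_nat => /eqP[].
by rewrite size_map size_iota ltnn.
Qed.

Section Perturbation.
Variables (R : realType) (V : finType) (X : V -> finType).
Implicit Types (K : V -> cfgV X -> R) (z : cfgV X) (C D : {set V}).

Definition perturb (t : R) K v z := (1 - t) * K v z + t / #|X v|%:R.

Definition marg_poly K C z : {poly R} :=
  \sum_(z' | agree C z' z) \prod_(v in [set: V])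
    ((K v z')%:P + 'X * (#|X v|%:R^-1 - K v z')%:P).

Lemma marg_polyE K C z t : (marg_poly K C z).[t] = marg (perturb t K) C z.
Proof.
rewrite /marg_poly horner_sum; apply: eq_bigr => z' _.
rewrite horner_prod; apply: eq_bigr => v _.
by rewrite !hornerE /perturb; ring.
Qed.

Lemma perturb0 K C z : marg (perturb 0 K) C z = marg K C z.
Proof.
apply: eq_bigr => z' _; apply: eq_bigr => v _.
by rewrite /perturb; ring.
Qed.

End Perturbation.

Section PolicyIndependence.
Variables (R : realType) (V : finType) (G : influence_diagram V).
Implicit Types (rho : parametrization R G) (C D : {set V}).

(* The equality of the conditional distributions of X_C given X_D, for [D] included
   in [C], in cross-multiplied form: no positivity is required. *)
Definition proportional rho (d d' : cond_family R G (states rho)) C D z :=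
  marg (kernel_of d) C z * marg (kernel_of d') D z
  = marg (kernel_of d') C z * marg (kernel_of d) D z.

(** If the conditioning event has probability zero under one of the policies, so does the event on
    [C], and both products vanish. *)
Lemma policy_independentP C D : policy_independent R G C D <->
  forall rho (d d' : cond_family R G (states rho)), is_policy d -> is_policy d' ->
    forall z, proportional d d' C (C :\: D) z.
Proof.
split=> H rho d d' dP d'P z; last first.
  rewrite !marginal_marg /cond_prob !marginal_marg => m0 m'0.
  by apply/eqP; rewrite eqr_div ?lt0r_neq0 //; apply/eqP; exact: (H rho d d' dP d'P z).
have kK := kernels_of dP; have kK' := kernels_of d'P.
have := H rho d d' dP d'P z; rewrite /cond_prob !marginal_marg /proportional.
have sub : C :\: D \subset C by exact: subsetDl.
have gt0 d1 : is_policy d1 -> marg (kernel_of d1) (C :\: D) z != 0 ->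
    0 < marg (kernel_of d1) (C :\: D) z.
  by move=> d1P; rewrite lt_neqAle eq_sym => ->; apply: marg_ge0 (kernels_of d1P).
have [m0|m0] := eqVneq (marg (kernel_of d) (C :\: D) z) 0.
  by move=> _; rewrite m0 (marg_eq0 kK sub m0) mul0r mulr0.
have [m'0|m'0] := eqVneq (marg (kernel_of d') (C :\: D) z) 0.
  by move=> _; rewrite m'0 (marg_eq0 kK' sub m'0) mul0r mulr0.
move=> /(_ (gt0 _ dP m0) (gt0 _ d'P m'0))/eqP.
by rewrite eqr_div // => /eqP.
Qed.

Lemma policy_independent0 C : policy_independent R G C set0.
Proof.
by apply/policy_independentP => rho d d' _ _ z; rewrite /proportional setD0 mulrC.
Qed.

Section Ratio.
Variables (rho : parametrization R G) (d d' : cond_family R G (states rho)).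
Hypothesis pos' : forall C z, 0 < marg (kernel_of d') C z.
Let X_gt0 := @states_nonempty R V G rho.
Let r C z := marg (kernel_of d) C z / marg (kernel_of d') C z.

(** Under positivity, independence says that the ratio of the two marginals on [C] is a function of
    the coordinates in [C :\: D]; in this form it passes to unions. *)
Lemma proportional_ratio C D :
  (forall z, proportional d d' C (C :\: D) z) <->
  (forall z z', agree (C :\: D) z z' -> r C z = r C z').
Proof.
split=> [H z z' zz'|H z].
  have rE z1 : r C z1 = r (C :\: D) z1.
    apply/eqP; rewrite eqr_div ?lt0r_neq0 //; apply/eqP.
    by rewrite [RHS]mulrC; exact: H.
  by rewrite !rE /r; congr (_ / _); apply: marg_agree.
have mE (d1 : cond_family R G (states rho)) : marg (kernel_of d1) (C :\: D) z =
    sum_out D (marginal d1 (C := C)) z by rewrite sum_out_marginal.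
rewrite /proportional !mE /sum_out !mulr_sumr; apply: eq_bigr => x.
have [z' ->] := proj_onto X_gt0 x; rewrite sum_out_condP !marginal_marg => zz'.
have := H _ _ zz'; rewrite /r => /eqP; rewrite eqr_div ?lt0r_neq0 // => /eqP.
by rewrite mulrC => ->; rewrite mulrC.
Qed.

(** The coordinates in [D1] are changed first, those in [D2] next. *)
Lemma proportionalU C D1 D2 :
  (forall z, proportional d d' C (C :\: D1) z) ->
  (forall z, proportional d d' C (C :\: D2) z) ->
  forall z, proportional d d' C (C :\: (D1 :|: D2)) z.
Proof.
move=> /proportional_ratio r1 /proportional_ratio r2.
apply/proportional_ratio => z z' /agreeP zz'.
pose z1 : cfgV (states rho) := [ffun v => if v \in D1 then z' v else z v].
rewrite (r1 z z1) ?(r2 z1 z') //; apply/agreeP => v; rewrite !inE ffunE.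
  by case: ifP => // vD1 /andP[vD2 vC]; apply: zz'; rewrite !inE vD1 (negbTE vD2).
by case: ifP.
Qed.

End Ratio.

Lemma perturb_distribution (T : finType) (q : T -> R) t : (0 < #|T|)%N ->
  0 <= t <= 1 -> is_distribution q ->
  is_distribution (fun x => (1 - t) * q x + t / #|T|%:R).
Proof.
move=> T0 /andP[t0 t1] [q0 q1]; split=> [x|].
  by rewrite addr_ge0 ?mulr_ge0 ?invr_ge0 ?ler0n // subr_ge0.
rewrite big_split /= -mulr_sumr q1 sumr_const -[X in _ + X]mulr_natr.
by rewrite mulfVK ?pnatr_eq0 -?lt0n // mulr1 subrK.
Qed.

Definition perturb_family (X : V -> finType) (t : R) (k : cond_family R G X) :
    cond_family R G X :=
  fun v y x => (1 - t) * k v y x + t / #|X v|%:R.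

(** The chance kernels are perturbed too. Policy independence, being required of all
    parametrizations, still applies to the result. *)
Definition perturb_rho rho t (t01 : 0 <= t <= 1) : parametrization R G :=
  Parametrization (@states_nonempty _ _ _ rho)
    (chance_kernel := perturb_family t (@chance_kernel _ _ _ rho))
    (fun v vS y => perturb_distribution (states_nonempty rho v) t01
       (kernel_distribution vS y)) (@reward _ _ _ rho).

Lemma perturb_policy rho (d : cond_family R G (states rho)) t (t01 : 0 <= t <= 1) :
  is_policy d ->
  is_policy (rho := perturb_rho rho t01) (perturb_family t d).
Proof.
move=> dP v vA y; apply: perturb_distribution => //.
  exact: states_nonempty.
exact: dP.
Qed.

Lemma kernel_of_perturb rho (d : cond_family R G (states rho)) t (t01 : 0 <= t <= 1) C z :
  marg (kernel_of (rho := perturb_rho rho t01) (perturb_family t d)) C z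
  = marg (perturb t (kernel_of d)) C z.
Proof.
apply: eq_bigr => z' _; apply: eq_bigr => v _.
by rewrite /kernel_of /perturb /perturb_family; case: ifP.
Qed.

Lemma perturb_gt0 rho (d : cond_family R G (states rho)) t C z :
  is_policy d -> 0 < t <= 1 -> 0 < marg (perturb t (kernel_of d)) C z.
Proof.
move=> dP /andP[t0 t1]; have kK := kernels_of dP.
rewrite /marg (bigD1 z) ?agree_refl //=.
have pos v z' : 0 < perturb t (kernel_of d) v z'.
  rewrite ltr_wpDl ?mulr_ge0 ?subr_ge0 ?(kernel_ge0 kK) // divr_gt0 // ltr0n.
  exact: states_nonempty.
apply: ltr_wpDr; last by apply: prodr_gt0.
by apply: sumr_ge0 => z' _; apply: prodr_ge0 => v _; apply: ltW.
Qed.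

(* For positive distributions this follows from the ratio criterion. In general,
   the identity is polynomial in the parameter of a perturbation that makes all
   the distributions positive. *)
Lemma policy_independentU C D1 D2 :
  policy_independent R G C D1 -> policy_independent R G C D2 ->
  policy_independent R G C (D1 :|: D2).
Proof.
move=> /policy_independentP i1 /policy_independentP i2; apply/policy_independentP.
move=> rho d d' dP d'P z.
pose D := C :\: (D1 :|: D2).
pose Q := marg_poly (kernel_of d) C z * marg_poly (kernel_of d') D z
        - marg_poly (kernel_of d') C z * marg_poly (kernel_of d) D z.
suff Q0 : Q = 0.
  have := congr1 (fun p : {poly R} => p.[0]) Q0.
  by rewrite !hornerE !marg_polyE !perturb0 => /eqP; rewrite subr_eq0 => /eqP.
apply: poly_unit_interval_eq0 => t t01.
have t01' : 0 <= t <= 1 by case/andP: t01 => /ltW->.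
apply/eqP; rewrite !hornerE subr_eq0 !marg_polyE.
rewrite -!(@kernel_of_perturb _ _ t t01'); apply/eqP.
have pos d1 (d1P : is_policy d1) C' z' :
    0 < marg (kernel_of (rho := perturb_rho rho t01') (perturb_family t d1)) C' z'.
  by rewrite kernel_of_perturb perturb_gt0.
have := (@proportionalU (perturb_rho rho t01') _ _ (pos _ d'P) C D1 D2
  (i1 _ _ _ (@perturb_policy _ _ _ t01' dP) (@perturb_policy _ _ _ t01' d'P))
  (i2 _ _ _ (@perturb_policy _ _ _ t01' dP) (@perturb_policy _ _ _ t01' d'P)) z).
exact.
Qed.

(** The largest set is the union of all the policy-independent subsets of [C]. *)
Lemma perpP C : is_perp R G C (perp R G C).
Proof.
pose D := \bigcup_(D : {set V} | (D \subset C) && `[< policy_independent R G C D >]) D.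
have Dperp : is_perp R G C D.
  split.
  - by apply/bigcupsP => D' /andP[].
  - apply: (big_ind (fun D => policy_independent R G C D)).
    + exact: policy_independent0.
    + by move=> D1 D2; exact: policy_independentU.
    + by move=> D' /andP[_ /asboolP].
  - move=> D' D'C D'i; apply: (finset.bigcup_sup D') => //.
    by rewrite D'C; apply/asboolP.
rewrite /perp; case: pickP => [D' /asboolP//|/(_ D)].
by move=> /asboolPn; case.
Qed.

End PolicyIndependence.

(** * Policy independence at the cliques of decisions *)

Section Splitting.
Variables (R : realType) (V : finType) (E : rel V) (X : V -> finType).
Hypothesis acyc : acyclic E.
Hypothesis X_gt0 : forall v, (0 < #|X v|)%N.

(* Exchanging the coordinates in [S] of the two configurations of the product
   exchanges the factors that differ. *)
Lemma marg_split (K K' : V -> cfgV X -> R) (A C Z S F : {set V}) z :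
  kernels E K -> kernels E K' -> ancestral E A ->
  C \subset A -> Z \subset C -> [disjoint S & C] ->
  {in A :&: F, forall w, Defs.family E w \subset S :|: Z} ->
  {in A :\: F, forall w, [disjoint Defs.family E w & S] /\ K w = K' w} ->
  marg K C z * marg K' Z z = marg K' C z * marg K Z z.
Proof.
move=> kK kK' aA CA ZC SC AF AnF.
have ZA : Z \subset A by exact: subset_trans ZC CA.
have c0 := free_card_neq0 R X_gt0 A; set c := free_card R X A in c0.
suff H : (marg K C z * c) * (marg K' Z z * c) = (marg K' C z * c) * (marg K Z z * c).
  have rE (x y : R) : x * y * c * c = x * c * (y * c) by ring.
  by apply: (mulIf c0); apply: (mulIf c0); rewrite !rE.
rewrite /c !(marg_weight acyc X_gt0 z _ aA) //.
rewrite !big_distrlr /= !pair_big /=.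
pose mix (a b : cfgV X) : cfgV X := [ffun v => if v \in S then a v else b v].
pose swap (p : cfgV X * cfgV X) := (mix p.2 p.1, mix p.1 p.2).
have swapK : involutive swap.
  by case=> a b; congr (_, _); apply/ffunP => v; rewrite !ffunE /=; case: ifP; rewrite ?ffunE // => ->.
have SZ u : u \in C -> u \notin S.
  by move=> uC; apply/negP => uS; have /pred0P/(_ u) := SC; rewrite /= uS uC.
have mixC a b (D : {set V}) : D \subset C -> agree D (mix a b) b.
  by move=> DC; apply/agreeP => u /(subsetP DC)/SZ uS; rewrite ffunE (negbTE uS).
have mixE a b (D : {set V}) : D \subset C -> agree D (mix b a) z = agree D a z.
  by move=> DC; rewrite !(agree_sym _ _ z) (agree_left z (mixC b a D DC)).
rewrite (reindex_inj (inv_inj swapK)) /=.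
apply: eq_big => [[a b]|[a b]] /=; rewrite !mixE //.
case/andP=> aC bZ; have aZ := agreeS ZC aC.
have wE (L : V -> cfgV X -> R) y : weight L A y =
    (\prod_(w in A :&: F) L w y) * (\prod_(w in A :\: F) L w y).
  rewrite /weight (bigID (mem F)) /=.
  by congr (_ * _); apply: eq_bigl => w; rewrite !inE // andbC.
have fE (L : V -> cfgV X -> R) (y' y2 : cfgV X) : kernels E L ->
    agree Z y' z -> agree Z y2 z ->
    \prod_(w in A :&: F) L w (mix y' y2) = \prod_(w in A :&: F) L w y'.
  move=> kL /agreeP y'Z /agreeP y2Z; apply: eq_bigr => w /AF sw; apply: (kernel_local kL).
  apply/agreeP => u /(subsetP sw); rewrite inE ffunE; case: ifP => //= _ uZ.
  by rewrite y'Z ?y2Z.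
have gE (L : V -> cfgV X -> R) (y' y2 : cfgV X) : kernels E L ->
    \prod_(w in A :\: F) L w (mix y' y2) = \prod_(w in A :\: F) L w y2.
  move=> kL; apply: eq_bigr => w /AnF[dw _]; apply: (kernel_local kL).
  apply/agreeP => u uw; rewrite ffunE ifF //; apply/negP => uS.
  by have /pred0P/(_ u) := dw; rewrite /= uw uS.
have gK y : \prod_(w in A :\: F) K w y = \prod_(w in A :\: F) K' w y.
  by apply: eq_bigr => w /AnF[_ ->].
rewrite !wE (@fE K b a) // (@fE K' a b) // !gE // !gK.
ring.
Qed.

End Splitting.

Section DecisionCliques.
Variables (V : finType) (G : influence_diagram V).
Notation E := (id_arc G).
Let acyc : acyclic E := @arc_acyclic V G.
Hypothesis sol : soluble G.
Variables (v : V) (C : {set V}).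
Hypothesis vA : v \in Va G.
Hypothesis faC : fa G v \subset C.
Hypothesis C_parent : forall c, c \in C -> c \notin fa G v ->
  exists2 w, w \in dsc E v & E c w.
Hypothesis C_decision : forall u c, u \in Va G -> c \in C -> connect E u c ->
  connect E u v.

Let A : {set V} := [set w | [exists (c | c \in C), connect E w c]].
Let Z := fa G v.
(** Adjacency in the moral graph of the ancestral closure [A] of [C], after deletion of [Z], with
    loops allowed. *)
Let moral := [rel a b | [&& a \notin Z, b \notin Z &
  [exists w in A, (a \in fa G w) && (b \in fa G w)]]].

Let inA w : reflect (exists2 c, c \in C & connect E w c) (w \in A).
Proof.
by rewrite inE; apply: (iffP existsP) => [[c /andP[]]|[c cC wc]]; exists c; rewrite ?cC.
Qed.

Let A_ancestral : ancestral E A.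
Proof.
move=> u w uw /inA[c cC wc]; apply/inA; exists c => //.
exact: connect_trans (connect1 uw) wc.
Qed.

Section FromDecision.
Variable u : {u | u \in Va G}.
Hypothesis unv : val u != v.
Hypothesis uv : connect E (val u) v.

Let nsr : ~ s_reachable v u.
Proof.
move=> vu.
have ru : relevance_arc G (val u) v.
  by apply: relevance_dsc (valP u) vA _; rewrite inE eq_sym unv.
have := soluble_asym sol ru; rewrite /relevance_arc vA /= => /asboolPn; apply.
by exists u.
Qed.

Let reached a := exists2 s, active_walk (@aug_arc V G) (aug_set G Z) (inl v)
   (rcons s (inl a)) & nth (inl v) (rcons s (inl a)) 0 = inr u.

(* Otherwise the walk extends from [a] down to a child of an element of [C], which
   is a descendant of [v]. *)
Let reached_anc a : a \in A -> reached a -> exists2 z, z \in Z & connect E a z.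
Proof.
move=> /inA[c cC ac] [s aw hd]; apply: contrapT => nZ.
have cZ : c \notin Z by apply/negP => cZ; apply: nZ; exists c.
have [w wv cw] := C_parent cC cZ.
have aw' : connect (@aug_arc V G) (inl a) (inl w).
  by rewrite connect_aug_inl; apply: connect_trans ac (connect1 cw).
case: (active_walk_down (@aug_acyclic V G) aw _ aw') => [z|s' aws' hd'].
  by case/imsetP=> z' z'Z ->; rewrite connect_aug_inl; apply/negP => az; apply: nZ; exists z'.
by apply: nsr; apply: walk_s_reachable aws' _ wv; rewrite hd'.
Qed.

Let reached_child a w : a \notin Z -> E a w -> reached a -> reached w.
Proof.
move=> aZ aw [s act hd]; exists (rcons s (inl a)); last by rewrite -hd; case: (s).
apply: active_walk_rcons => //; first by rewrite /usym /= aw.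
right; apply/aug_unblocked_inl; rewrite ifF //.
by apply/negP => /andP[_ wa]; move: wa; rewrite /= (acyclic_asym acyc aw).
Qed.

Let reached_parent a b : a \notin Z -> (exists2 z, z \in Z & connect E a z) ->
  E b a -> reached a -> reached b.
Proof.
move=> aZ az ba [s act hd]; exists (rcons s (inl a)); last by rewrite -hd; case: (s).
apply: active_walk_rcons => //; first by rewrite /usym /= ba orbT.
by right; apply/aug_unblocked_inl; case: ifP.
Qed.

Let reached_coparent a b w : a \notin Z -> E a w -> E b w ->
  (exists2 z, z \in Z & connect E w z) -> reached a -> reached b.
Proof.
move=> aZ aw bw wz [s act hd].
exists (rcons (rcons s (inl a)) (inl w)); last by rewrite -hd; case: (s).
apply: active_walk_rcons => //; last 1 first.
- by right; apply/aug_unblocked_inl; rewrite last_rcons /= aw bw.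
- apply: active_walk_rcons => //; first by rewrite /usym /= aw.
  right; apply/aug_unblocked_inl; rewrite ifF //.
  by apply/negP => /andP[_ wa]; move: wa; rewrite /= (acyclic_asym acyc aw).
by rewrite /usym /= bw orbT.
Qed.

(** For a parent [a] of [u], the collider at [u] is open because [u] is an ancestor of [v], which is
    in [Z]. *)
Let reached_fa a : a \in fa G (val u) -> reached a.
Proof.
rewrite !inE => /orP[/eqP->|au].
  by exists [:: inr u]; first exact: active_walk2.
exists [:: inr u; inl (val u)] => //.
apply: (@active_walk_rcons _ _ _ _ [:: inr u] (inl (val u))).
- exact: active_walk2.
- by rewrite /usym /= (_ : id_arc G a (val u)) ?orbT.
right; apply/aug_unblocked_inl; rewrite /= eqxx (_ : id_arc G a (val u)) //.
by exists v; rewrite ?inE ?eqxx.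
Qed.

(** A moral edge is an arc or joins two parents of some [w] in [A]. Any collider this creates is
    open, because a reached vertex of [A] is an ancestor of [Z]. *)
Let reached_moral a b : moral a b -> reached a -> reached b.
Proof.
case/and3P=> aZ bZ /existsP[w /and3P[wA]]; rewrite !inE.
case/orP=> [/eqP aw|aw] /orP[/eqP bw|bw] ra; first by rewrite bw -aw.
- subst w; exact: reached_parent aZ (reached_anc wA ra) bw ra.
- by subst w; exact: reached_child aZ aw ra.
exact: reached_coparent aZ aw bw (reached_anc wA (reached_child aZ aw ra)) ra.
Qed.

Lemma moral_connect_notin a b : a \in fa G (val u) -> a \notin Z ->
  connect moral a b -> b \notin C.
Proof.
move=> au aZ ab.
have [rb bZ] : reached b /\ b \notin Z.
  case/connectP: ab => p; elim: p a {au} (reached_fa au) aZ => [|x p IH] a ra aZ /=.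
    by move=> _ ->.
  case/andP=> ax xp; apply: IH xp; first exact: reached_moral ax ra.
  by case/and3P: ax.
apply/negP => bC; have [w wv bw] := C_parent bC bZ.
have [s aw hd] := reached_child bZ bw rb.
by apply: nsr; exact: walk_s_reachable aw hd wv.
Qed.

End FromDecision.

Lemma policy_independent_fa (R : realType) : policy_independent R G C (C :\: fa G v).
Proof.
apply/policy_independentP => rho d d' dP d'P z; rewrite /proportional.
have -> : C :\: (C :\: fa G v) = Z.
  apply/setP => x; rewrite !in_setD -/Z.
  have [xZ|xZ] := boolP (x \in Z); first by rewrite (subsetP faC _ xZ).
  by case: (x \in C).
(* [S] is the part of the moral graph reached from the families of the decisions of [A] other than
   [v]; it avoids [C]. The family of [v] is [Z], and a family that meets [S] lies in [S :|: Z], so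
   [marg_split] applies with [F] the decisions and the vertices whose family meets [S]. *)
pose S : {set V} := [set a | [exists u in Va G, [&& u \in A, u != v &
   [exists a0 in fa G u, (a0 \notin Z) && connect moral a0 a]]]].
have inS a : reflect (exists u a0, [/\ u \in Va G, u \in A, u != v &
    [/\ a0 \in fa G u, a0 \notin Z & connect moral a0 a]]) (a \in S).
  rewrite inE; apply: (iffP existsP) => [[u /and4P[uA uA' uv /existsP[a0 /and3P[*]]]]|].
    by exists u, a0; split.
  case=> u [a0 [uA uA' uv [a0u a0Z a0a]]]; exists u; rewrite uA uA' uv /=.
  by apply/existsP; exists a0; rewrite a0u a0Z.
have SC a : a \in S -> a \notin C.
  case/inS=> u [a0 [uA /inA[c cC uc] uv [a0u a0Z a0a]]].
  exact: (@moral_connect_notin (exist _ u uA) uv (C_decision uA cC uc) a0).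
have SZ a : a \in S -> a \notin Z.
  by move=> /SC; apply: contra; exact: (subsetP faC).
pose F := [set w | (w \in Va G) || ~~ [disjoint fa G w & S]].
have CA : C \subset A by apply/subsetP => c cC; apply/inA; exists c.
apply: (@marg_split _ _ _ _ acyc (states_nonempty rho) _ _ A _ _ S F _
  (kernels_of dP) (kernels_of d'P) A_ancestral CA faC).
- by apply/pred0P => a /=; apply/negP => /andP[aS aC]; have := SC _ aS; rewrite aC.
- move=> w; rewrite in_setI => /andP[wA wF]; apply/subsetP => a aw.
  rewrite inE; have [aZ|aZ] := boolP (a \in Z); rewrite ?orbT ?orbF //.
  have [wVa|wVa] := boolP (w \in Va G).
    apply/inS; exists w, a; split=> //.
    by apply: contraNneq aZ => wv; rewrite wv in aw.
  move: wF; rewrite inE (negbTE wVa) /= => /pred0Pn[b /andP[/= bw bS]].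
  have bZ := SZ _ bS.
  case/inS: bS => u [a0 [? ? ? [? ? a0b]]]; apply/inS; exists u, a0; split=> //; split=> //.
  apply: connect_trans a0b (connect1 _); rewrite /= bZ aZ.
  by apply/existsP; exists w; rewrite wA bw.
move=> w; rewrite !inE negb_or negbK => /andP[/andP[wVa dw] wA]; split=> //.
by apply: funext => y; rewrite /kernel_of (negbTE wVa).
Qed.

End DecisionCliques.

(** * Reconstruction of a policy from its moments *)

Section Moments.
Variables (R : realType) (V : finType) (G : influence_diagram V).
Variables (Cl : V -> {set V}) (a : rel {set V}) (le : rel V).
Notation E := (id_arc G).
Let acyc : acyclic E := @arc_acyclic V G.
Hypothesis tG : topological_order [set: V] E le.
Hypothesis fa_Cl : forall v, fa G v \subset Cl v.
Hypothesis Cl_le : forall v c, c \in Cl v -> le c v.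
Variable rho : parametrization R G.
Notation X := (states rho).
Let X_gt0 := @states_nonempty R V G rho.
Implicit Types (d : cond_family R G X) (z : cfgV X).

Definition before v : {set V} := [set w | (w != v) && le w v].

Lemma before_ancestral v : ancestral E (before v).
Proof.
case: tG => rl an tr to el u w uw; rewrite !inE => /andP[wv lwv].
have /andP[nuw luw] := el u w (in_setT _) (in_setT _) uw.
have luv : le u v by apply: (tr w); rewrite ?inE.
rewrite luv andbT; apply: contraNneq nuw => uv; apply/eqP; apply: an; rewrite ?inE //.
by rewrite luw uv lwv.
Qed.

Lemma before_irr v : v \notin before v.
Proof. by rewrite inE eqxx. Qed.

Lemma Cl_before v : Cl v :\ v \subset before v.
Proof. by apply/subsetP => c; rewrite !inE => /andP[-> /Cl_le]. Qed.

Lemma mem_Cl v : v \in Cl v.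
Proof. by apply: (subsetP (fa_Cl v)); rewrite !inE eqxx. Qed.

Lemma marg_Cl d v z : is_policy d ->
  marg (kernel_of d) (Cl v) z = marg (kernel_of d) (Cl v :\ v) z * kernel_of d v z.
Proof.
move=> dP; apply: (marg_markov acyc X_gt0 z (kernels_of dP) (@before_ancestral v)).
- exact: before_irr.
- exact: fa_Cl.
exact: Cl_before.
Qed.

Lemma marginal_distribution d (C : {set V}) : is_policy d ->
  is_distribution (marginal d (C := C)).
Proof.
move=> dP; split=> [x|].
  have [z ->] := proj_onto X_gt0 x.
  by rewrite marginal_marg; apply: marg_ge0 (kernels_of dP).
have := sum_out_marginal d C C (cfg0 X_gt0); rewrite setDv (marg0 acyc _ (kernels_of dP)) => <-.
apply: eq_bigl => x; apply/esym/forallP => -[u uC].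
by rewrite /= uC.
Qed.

(** Where the kernel takes its uniform default value, no policy charges the conditioning event, and
    both sides are zero. *)
Lemma perp_kernel_marg d C z : is_policy d ->
  perp_kernel C z * marg (kernel_of d) (C :\: perp R G C) z = marg (kernel_of d) C z.
Proof.
move=> dP; have kK := kernels_of dP.
have [_ /policy_independentP pI _] := perpP R G C.
rewrite /perp_kernel; case: pselect => [h|nh].
  case: (cid h) => d' /= [d'P]; rewrite /cond_prob !marginal_marg => pos.
  have := pI rho d d' dP d'P z; rewrite /proportional => H.
  by apply: (mulIf (lt0r_neq0 pos)); rewrite H mulrAC mulrVK ?unitfE ?lt0r_neq0.
have m0 : marg (kernel_of d) (C :\: perp R G C) z = 0.
  apply/eqP; apply: contraT => m0; exfalso; apply: nh; exists d; split=> //.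
  by rewrite marginal_marg lt_neqAle eq_sym m0; apply: marg_ge0 kK.
by rewrite m0 mulr0 (marg_eq0 kK _ m0) // subsetDl.
Qed.

Lemma achievable_subset_Pperp (mu : rjt_moments rho Cl) :
  achievable_rjt rho Cl mu -> Pperp rho Cl a mu.
Proof.
case=> -[d dP mE] red.
have sE v D z : sum_out D (mom mu v) z = marg (kernel_of d) (Cl v :\: D) z.
  by rewrite -sum_out_marginal; apply: (eq_sum_out X_gt0) => z' _; exact: mE.
split; [split; [split|]|].
- by move=> v; rewrite (_ : mom mu v = marginal d (C := Cl v));
    [exact: marginal_distribution | apply: funext => x; exact: mE].
- by move=> u v _ z; rewrite !sE !setDDr !setDv !set0U setIC.
- exact: red.
- move=> v vs z; rewrite mE red sE marginal_marg marg_Cl //.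
  by congr (_ * _); move: vs; rewrite /kernel_of inE => /negbTE->.
move=> v vA z; rewrite mE marginal_marg sE.
by rewrite perp_kernel_marg.
Qed.

Hypothesis Cl_root : forall v, Cl v :\ v = set0 \/
  exists u, [/\ a (Cl u) (Cl v), u \in before v & Cl v :\: Cl u = [set v]].
Hypothesis Cl_perp : forall v, v \in Va G -> Cl v :\: fa G v \subset perp R G (Cl v).

Section Reconstruction.
Variable mu : rjt_moments rho Cl.
Hypothesis muP : Pperp rho Cl a mu.

Let mu_distr v : is_distribution (mom mu v).
Proof. by case: muP => -[[]]. Qed.
Let mu_ge0 v x : 0 <= mom mu v x. Proof. by case: (mu_distr v). Qed.

Let f v z := sum_out (Cl v :\: fa G v) (mom mu v) z.
(** The conditional distribution of X_v given X_(pa v) under [mu], completed by the uniform one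
    where the parents have mass zero. *)
Let g v z := let s := \sum_(x : X v) f v (upd z x) in
  if s == 0 then #|X v|%:R^-1 else f v z / s.

Let f_ge0 v z : 0 <= f v z. Proof. by apply: sum_out_ge0 => x. Qed.

Let f_local v z z' : agree (fa G v) z z' -> f v z = f v z'.
Proof.
move=> zz'; apply: sum_out_agree => //; apply: agreeS zz'.
by rewrite setDDr setDv set0U subsetIr.
Qed.

Let g_local v z z' : agree (fa G v) z z' -> g v z = g v z'.
Proof.
move=> zz'; rewrite /g (f_local zz').
have -> // : \sum_(x : X v) f v (upd z x) = \sum_(x : X v) f v (upd z' x).
apply: eq_bigr => x _; apply: f_local.
by apply: agreeS (agree_upd2 x zz'); apply: subsetU; rewrite subxx orbT.
Qed.

Let g_ge0 v z : 0 <= g v z.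
Proof.
by rewrite /g; case: ifP => _; rewrite ?invr_ge0 ?ler0n // divr_ge0 ?sumr_ge0.
Qed.

Let g_sum1 v z : \sum_(x : X v) g v (upd z x) = 1.
Proof.
rewrite /g; under eq_bigr => x _ do under eq_bigr do rewrite upd_upd.
case: eqP => [_|/eqP s0].
  by have := kernel_sum1 (kernels_uniform R (fun _ _ => false) X_gt0) v z.
by rewrite -mulr_suml divff.
Qed.

Let d : cond_family R G X := cond_of X_gt0 g.

Let dP : is_policy d.
Proof. by move=> v vA y; apply: cond_of_distribution. Qed.

Let kernel_of_d v z : v \in Va G -> kernel_of d v z = g v z.
Proof.
move=> vA; rewrite /kernel_of vA; apply: cond_ofE => z'; exact: g_local.
Qed.

Let K := kernel_of d.
Let kK : kernels E K := kernels_of dP.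

Section Step.
Variable v : V.
Hypothesis IH : forall u z, u \in before v -> mom mu u (proj (Cl u) z) = marg K (Cl u) z.

Let c z := sum_out [set v] (mom mu v) z.

(** The moment on [Cl v :\ v] is inherited from the clique of the tree parent, known by induction;
    at a root both sides are 1. *)
Let cE z : c z = marg K (Cl v :\ v) z.
Proof.
case: (Cl_root v) => [C0|[u [auv uv Cvu]]].
  rewrite C0 (marg0 acyc z kK); case: (mu_distr v) => _ <-.
  apply: eq_bigl => x; apply/forallP => -[u uC] /=.
  have : u \notin Cl v :\ v by rewrite C0 inE.
  by rewrite !inE uC andbT negbK => ->.
case: muP => -[[_ arcs _] _] _.
rewrite /c -Cvu -arcs // (eq_sum_out X_gt0 (m' := marginal d (C := Cl u))); last first.
  by move=> z' _; rewrite IH // marginal_marg.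
by rewrite sum_out_marginal; congr marg; rewrite !setDDr !setDv !set0U setIC.
Qed.

Let m_le_c z : mom mu v (proj (Cl v) z) <= c z.
Proof. by apply: le_sum_out => // x. Qed.

Let step_chance z : v \notin Va G -> mom mu v (proj (Cl v) z) = marg K (Cl v) z.
Proof.
move=> vA; have vs : v \in Vs G by rewrite inE.
case: muP => -[[_ _ red] ch] _.
by rewrite ch // red -/(c z) cE /K marg_Cl // /kernel_of (negbTE vA).
Qed.

Section Decision.
Hypothesis vA : v \in Va G.
Let n : R := #|X v|%:R.
Let n_gt0 : 0 < n. Proof. by rewrite ltr0n. Qed.

(* With [d0], the clique of [v] has positive probability wherever [mu] does, so that
   [perp_kernel] is given by [d0] there. *)
Let d0 : cond_family R G X := fun w y x => if w == v then #|X w|%:R^-1 else d y x.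
Let K0 := kernel_of d0.

Let d0P : is_policy d0.
Proof.
move=> w wA y; rewrite /d0; case: eqP => _; last exact: dP.
split=> [x|]; first by rewrite invr_ge0 ler0n.
exact: (kernel_sum1 (kernels_uniform R (fun _ _ => false) X_gt0) w (cfg0 X_gt0)).
Qed.

Let kK0 : kernels E K0 := kernels_of d0P.

Let K0v z : K0 v z = n^-1.
Proof. by rewrite /K0 /kernel_of vA /d0 eqxx. Qed.

Let m0 z := marg K0 (Cl v) z.

Let m0E z : m0 z = c z / n.
Proof.
rewrite /m0 /K0 marg_Cl // -/K0 K0v cE; congr (_ / _).
apply: (marg_eq acyc X_gt0 z kK0 kK (@before_ancestral v) (Cl_before v)) => w z'.
by rewrite inE /K0 /K /kernel_of /d0 => /andP[/negbTE-> _].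
Qed.

Let D := perp R G (Cl v).
Let s z := sum_out D (mom mu v) z.
Let h z := s z / marg K0 (Cl v :\: D) z.

(** The perp constraint holds with the kernel computed from [d0]. Where [m0] vanishes, so does [c],
    which bounds [mu]. *)
Let mE z : mom mu v (proj (Cl v) z) = m0 z * h z.
Proof.
case: muP => _ /(_ v vA z); rewrite -/D -/(s z) => mk.
have [D0|D0] := eqVneq (marg K0 (Cl v :\: D) z) 0.
  have m00 : m0 z = 0 by apply: (marg_eq0 kK0 _ D0); exact: subsetDl.
  rewrite m00 mul0r; apply/eqP; rewrite eq_le mu_ge0 andbT.
  apply: le_trans (m_le_c z) _; move/eqP: m00; rewrite m0E mulf_eq0 invr_eq0.
  by rewrite (gt_eqF n_gt0) orbF => /eqP->.
rewrite mk /h /m0 -(perp_kernel_marg _ z d0P) -/K0 -/D.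
by field.
Qed.

Let h_local z z' : agree (fa G v) z z' -> h z = h z'.
Proof.
move=> zz'; have {}zz' : agree (Cl v :\: D) z z'.
  apply: agreeS zz'; apply/subsetP => x; rewrite inE => /andP[xD xC].
  by apply: contraNT xD => xf; apply: (subsetP (Cl_perp vA)); rewrite in_setD xf.
by rewrite /h /s (sum_out_agree X_gt0 _ zz') (marg_agree _ zz').
Qed.

Let p z := marg K0 (pa G v) z.

(** [h] depends only on the family of [v], so it leaves the sum; under [K0], X_v is uniform given
    its parents. *)
Let fE z : f v z = h z * p z / n.
Proof.
have -> : f v z = h z * marg K0 (fa G v) z.
  rewrite -(_ : Cl v :\: (Cl v :\: fa G v) = fa G v); last first.
    by rewrite setDDr setDv set0U; apply/setIidPr.
  rewrite -sum_out_marginal mulr_sumr; apply: eq_bigr => x.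
  have [z' ->] := proj_onto X_gt0 x; rewrite sum_out_condP => zz'.
  rewrite mE marginal_marg mulrC; congr (_ * _); apply: h_local.
  apply: agreeS zz'; rewrite setDDr setDv set0U subsetI fa_Cl subxx //.
have sub : fa G v :\ v \subset before v.
  by apply: subset_trans (Cl_before v); apply: setSD; exact: fa_Cl.
rewrite (marg_markov acyc X_gt0 z kK0 (@before_ancestral v) (before_irr v) (subxx _) sub).
by rewrite K0v mulrA family_fa setU1K // pa_irr.
Qed.

(** Where [c] is nonzero, summing [mE] over the value at [v] shows that [h] sums to [n]. Hence [f]
    sums to [p], so that [g] is [h / n], and the moment [c * h / n] is the one of the policy. Where
    [c] vanishes, both sides do. *)
Lemma moment_step_decision z : mom mu v (proj (Cl v) z) = marg K (Cl v) z.
Proof.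
rewrite /K marg_Cl // kernel_of_d // -/K -cE.
have [c0|c0] := eqVneq (c z) 0.
  rewrite c0 mul0r; apply/eqP; rewrite eq_le mu_ge0 andbT.
  by apply: le_trans (m_le_c z) _; rewrite c0.
have cu (x : X v) : c (upd z x) = c z.
  rewrite !cE; apply: marg_agree; apply: agree_upd.
  by rewrite !inE eqxx.
have pu (x : X v) : p (upd z x) = p z by apply: marg_agree; apply: agree_upd; exact: pa_irr.
have hn : \sum_(x : X v) h (upd z x) = n.
  have := sum_out1 X_gt0 (mom mu v) z (mem_Cl v); rewrite -/(c z).
  under eq_bigr => x _ do rewrite mE m0E cu mulrAC -mulrA.
  rewrite -mulr_sumr -mulr_suml => cz.
  have : c z * (\sum_(x : X v) h (upd z x) / n) = c z * 1 by rewrite mulr1 -mulr_suml.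
  by move/(mulfI c0); rewrite -mulr_suml => /(canRL (divfK (lt0r_neq0 n_gt0))); rewrite mul1r.
have p0 : p z != 0.
  apply: lt0r_neq0; apply: (marg_gt0S kK0 (D := Cl v)).
    by apply: subset_trans (fa_Cl v); exact: subsetUr.
  rewrite -/(m0 z) m0E divr_gt0 // lt_neqAle eq_sym c0.
  by apply: sum_out_ge0.
have sE : \sum_(x : X v) f v (upd z x) = p z.
  under eq_bigr => x _ do rewrite fE pu -mulrA.
  by rewrite -mulr_suml hn mulrC mulfVK // lt0r_neq0.
rewrite /g sE (negbTE p0) mE m0E fE.
by field; rewrite p0 lt0r_neq0.
Qed.

End Decision.

Lemma moment_step z : mom mu v (proj (Cl v) z) = marg K (Cl v) z.
Proof.
by have [vA|vA] := boolP (v \in Va G); [exact: moment_step_decision | exact: step_chance].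
Qed.

End Step.

Lemma Pperp_achievable : achievable_rjt rho Cl mu.
Proof.
split; last by case: muP => -[[]].
exists d => // v x; have [z ->] := proj_onto X_gt0 x; rewrite marginal_marg -/K.
have [k] := ubnP #|before v|; elim: k v z {x} => // k IHk v z /ltnSE cv.
apply: moment_step => u z' uv; apply: IHk; apply: leq_trans cv.
apply: proper_card; apply/properP; split; last by exists u; rewrite // before_irr.
apply/subsetP => w wu; case: tG => rl an tr to el; move: wu uv.
rewrite !inE => /andP[wu lwu] /andP[uv luv].
have lwv : le w v by apply: (tr u); rewrite ?inE.
rewrite lwv andbT; apply: contraNneq wu => wv; apply/eqP; apply: an; rewrite ?inE //.
by rewrite lwu wv luv.
Qed.

End Reconstruction.

Lemma Pperp_eq_achievable : Pperp rho Cl a = achievable_rjt rho Cl.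
Proof.
apply/seteqP; split => mu; first exact: Pperp_achievable.
exact: achievable_subset_Pperp.
Qed.

End Moments.

(** * The output of Algorithm B on a soluble diagram *)

Section SolubleOutput.
Variables (R : realType) (V : finType) (G : influence_diagram V).
Hypothesis sol : soluble G.
Notation E := (id_arc G).
Variables leH le : rel V.
Hypothesis tH : topological_order (Va G) (relevance_arc G) leH.
Hypothesis tG : topological_order [set: V] (id_arc'' G leH) le.
Let tE : topological_order [set: V] E le := topological_arc tG.
Let out := algorithmA G le.
Notation Cl := (out.1).

Let le_anti x y : le x y -> le y x -> x = y.
Proof. by case: tG => _ an _ _ _ xy yx; apply: an; rewrite ?inE ?xy. Qed.

(** [clique_upper] puts [c] in the family of a vertex connected to [v], which [connect_upper_dsc]
    makes a descendant of [v]. It is not [c] itself, since [c] is not after [v]. *)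
Lemma clique_parent v c : v \in Va G -> c \in Cl v -> c \notin fa G v ->
  exists2 w, w \in dsc E v & E c w.
Proof.
move=> vA cv cf; have [w cw vw] := clique_upper tE cv.
have := connect_upper_dsc sol tH tG vA vw.
rewrite in_setU1 => /orP[/eqP wv|wv]; first by rewrite wv (negbTE cf) in cw.
exists w => //; move: cw; rewrite !inE => /orP[/eqP cw|//].
move: wv; rewrite -cw inE => /andP[ncv /(topological_connect tE) lvc].
by rewrite (le_anti lvc (clique_le tE cv)) eqxx in ncv.
Qed.

(** Outside [fa v], [c] is a parent of a descendant of [v], so [u] and [v] share a descendant and
    are comparable. If [v] were an ancestor of [u], it would be one of [c], which is not after
    [v]. *)
Lemma clique_decision v u c : v \in Va G -> u \in Va G -> c \in Cl v ->
  connect E u c -> connect E u v.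
Proof.
move=> vA uA cv uc; have [cf|cf] := boolP (c \in fa G v).
  by apply: connect_trans uc _; exact: fa_connect.
have [w wv cw] := clique_parent vA cv cf.
have wu : w \in dsc E u.
  apply: (dsc_step (@arc_acyclic _ G) _ cw); rewrite !inE uc andbT orbN //.
case/orP: (soluble_comparable sol uA vA wu wv) => // vu.
have lvc := topological_connect tE (connect_trans vu uc).
have cE := le_anti lvc (clique_le tE cv).
by move: cf; rewrite -cE !inE eqxx.
Qed.

Lemma clique_perp v : v \in Va G -> Cl v :\: fa G v \subset perp R G (Cl v).
Proof.
move=> vA; have [_ _ +] := perpP R G (Cl v); apply; first exact: subsetDl.
apply: policy_independent_fa => //.
- exact: fa_clique.
- by move=> c; exact: clique_parent.
- by move=> u c; exact: clique_decision.
Qed.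

Lemma algorithmB_Pperp (rho : parametrization R G) :
  Pperp rho Cl (out_arc out) = achievable_rjt rho Cl.
Proof.
apply: (Pperp_eq_achievable tE) => [v|v c|v|].
- exact: fa_clique.
- exact: clique_le.
- have [|/set0Pn[x]] := eqVneq (Cl v :\ v) set0; first by left.
  rewrite in_setD1 => /andP[nxv xv]; right.
  have [u uv] := tree_parent_ex tE xv nxv; exists u; split.
  + by rewrite out_arcE.
  + by rewrite inE (tree_parent_neq tE uv) (tree_parent_le tE uv).
  apply/setP => y; rewrite in_setD in_set1.
  have [->|nyv] := eqVneq y v; first by rewrite self_clique // andbT (tree_parent_nin tE uv).
  apply/negP => /andP[yu yv]; case/negP: yu.
  exact: tree_parent_sub uv yv nyv.
by move=> v; exact: clique_perp.
Qed.

End SolubleOutput.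

Lemma soluble_algorithmB (R : realType) (V : finType) (G : influence_diagram V) :
  soluble G -> algorithmB_succeeds G /\
     forall out : algA_state V, algorithmB G out ->
       [/\ rooted_junction_tree G (out_nodes out) (out_arc out),
           forall u v : V,
             root_clique (out_nodes out) (out_arc out) u (out.1 v) <-> u = v
         & forall rho : parametrization R G,
             Pperp rho out.1 (out_arc out) = achievable_rjt rho out.1].
Proof.
move=> sol; split; first exact: soluble_algorithmB_succeeds.
move=> out [leH [le [tH tG ->]]]; split.
- exact: algorithmA_rooted_junction_tree (topological_arc tG).
- by move=> u v; apply: root_cliqueE; exact: topological_arc tG.
- exact: algorithmB_Pperp tH tG.
Qed.

Theorem theorem5 (R : realType) (V : finType) (G : influence_diagram V)
    (hutil : forall v : V, v \in Vr G \/
       exists2 u : V, u \in dsc (id_arc G) v & u \in Vr G) :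
  (~ soluble G ->
     exists rho : parametrization R G,
       forall (N : {set {set V}}) (e : rel {set V}),
         junction_tree G N e -> ~ convex_set (achievable rho N))
  /\
  (soluble G ->
     algorithmB_succeeds G /\
     forall out : algA_state V, algorithmB G out ->
       [/\ rooted_junction_tree G (out_nodes out) (out_arc out),
           forall u v : V,
             root_clique (out_nodes out) (out_arc out) u (out.1 v) <-> u = v
         & forall rho : parametrization R G,
             Pperp rho out.1 (out_arc out) = achievable_rjt rho out.1]).
Proof.
split; [exact: not_soluble_not_convex | exact: soluble_algorithmB].
Qed.
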